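(* Let $\widetilde{M}=(M,F,V,\lambda,M=M_0\oplus M_1)$ be a unitary $\mathrm{BT}_1$ module of signature $(a,b)$, and for $i\in\{0,1\}$ let $B_i=\{e_{i,1},\dots,e_{i,q}\}$ be a basis of $M_i$ ($q=a+b$) such that $F$ and $V$ preserve $B=B_0\cup B_1$. Suppose the underlying $\mathrm{BT}_1$ module admits a decomposition $\overline{M}=(M,F,V) = \bigoplus _{w\in W} \overline{M}(w)$, with $W$ a multiset of words, such that: (1) every factor $\overline M(w)$ is spanned by elements of $B$ (which implies that every $w\in W$ has even length); (2) every word $w\in W$ is either primitive or of the form $w=zz$, where $z$ is primitive of odd length; (3) for each $w=u_{\ell-1}\cdots u_0\in W$, the letter $u_0$ signifies either $F(e_{0,j})=e_{1,j'}$ or $V(e_{1,j'})=e_{0,j}$ for some $j,j'$. Then $\gamma(W)$ is the minimal length representative of the coset of $(\mathfrak{S}_a \times \mathfrak{S}_b) \setminus \mathfrak{S}_q$, where $q=q_W$, that corresponds to the Ekedahl--Oort stratum of $\widetilde{M}$ (i.e. to the isomorphism class of $\widetilde M$) under Moonen's bijection.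
   Context: $k$ is an algebraically closed field of prime characteristic $p>2$. Words. A word is a nonempty finite string $w=u_{\ell-1}\cdots u_0$ in the alphabet $\{\mathtt f,\mathtt v\}$, of length $\ell(w)=\ell$; $z^n$ is the concatenation of $n$ copies of $z$; $w$ is primitive if it is not $z^n$ with $n>1$. Rotation: $\tau(u_{\ell-1}\cdots u_0)=u_0u_{\ell-1}\cdots u_1$. $\preceq$ is the lexicographic order (read left to right) on words of equal length with $\mathtt f\preceq\mathtt v$. Modules. A $\mathrm{BT}_1$ module is $(M,F,V)$ with $M$ a finite-dimensional $k$-vector space, $F$ Frobenius-linear, $V$ inverse-Frobenius-linear, $\ker F=\operatorname{im}V$, $\ker V=\operatorname{im}F$. For $w=u_{\ell-1}\cdots u_0$, $\overline M(w)$ has basis $a_0,\dots,a_{\ell-1}$ (indices mod $\ell$) with $F(a_j)=a_{j+1}$ if $u_j=\mathtt f$ and $0$ if $u_j=\mathtt v$; $V(a_{j+1})=a_j$ if $u_j=\mathtt v$ and $0$ if $u_j=\mathtt f$. In the decomposition of the statement, the standard basis vectors $a_j$ of each factor $\overline M(w)$ are elements of $B$; condition (3) says that $a_0\in B_0$ for each factor. A unitary $\mathrm{BT}_1$ module is $(M,F,V,\lambda,M=M_0\oplus M_1)$ with $(M,F,V)$ a $\mathrm{BT}_1$ module, $\lambda$ a symplectic form on $M$ with $\lambda(F(x),y)=\lambda(x,V(y))^p$, $F$ and $V$ mapping $M_i$ into $M_{1-i}$, and $M_0,M_1$ Lagrangian. Its signature is $(a,b)=(\dim_k\ker(F|_{M_1}),\dim_k\ker(F|_{M_0}))$;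 $q=a+b$, so $\dim_kM=2q$. ''$F$ and $V$ preserve $B$'' means $F$ and $V$ send each element of $B$ to an element of $B$ or to $0$. The permutation $\gamma(W)$. Let $L_W=\operatorname{lcm}_{w\in W}\ell(w)$, and let $\widetilde W$ be the multiset $\{(\tau^{2j}(w))^{L_W/\ell(w)} : w\in W,\ 0\le j<\ell(w)/2\}$ (counted with multiplicity), $q_W=\#\widetilde W$. Order its elements (with multiplicity) as $\widetilde\omega_1\preceq\cdots\preceq\widetilde\omega_{q_W}$. Let $z_1<\cdots<z_b$ be the indices $s$ for which $\widetilde\omega_s$ has $\mathtt v$ as its right-most letter. Then $\gamma(W)=\gamma_{z_1,\dots,z_b}:=(b,b+1,\dots,z_b)\cdots(2,3,\dots,z_2)(1,2,\dots,z_1)\in\mathfrak S_{q_W}$ (product of cycles, composed right to left). Moonen's bijection. In $\mathfrak S_q$ with simple reflections $s_i=(i,i+1)$, let $\mathbf W_{(a,b)}$ (isomorphic to $\mathfrak S_a\times\mathfrak S_b$) be the subgroup generated by $\{s_1,\dots,s_{q-1}\}\setminus\{s_b\}$, and $\mathbf W(a,b)$ the set of minimal-length representatives of the cosets $\mathbf W_{(a,b)}\backslash\mathfrak S_q$. Moonen's bijection between isomorphism classes of unitary $\mathrm{BT}_1$ modules of signature $(a,b)$ (equivalently, Ekedahl--Oort strata of the unitary Shimura variety of signature $(a,b)$) and $\mathbf W(a,b)$ is given as follows: choose a final filtration $W_\bullet$ of $M$, i.e. a filtration by subspaces, stable under $F$ and $V^{-1}$, containing a space of each dimension from $1$ to $2q$;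 let $C_{0,s}$ be the $s$-dimensional member of $W_\bullet\cap M_0$ and put $\eta(s)=\dim_k\ker(F|_{C_{0,s}})$ for $1\le s\le q$ (with $\eta(0)=0$); let $z_1<\cdots<z_b$ be the integers with $\eta(z_m)=\eta(z_m-1)+1$. Then $\widetilde M$ corresponds to $\gamma_{z_1,\dots,z_b}\in\mathbf W(a,b)$. *)

(* Defs.v *)
From mathcomp Require Import all_boot all_order all_algebra all_fingroup.
From mathcomp Require Import sesquilinear.

Set Implicit Arguments.
Unset Strict Implicit.
Unset Printing Implicit Defensive.

Import Order.TTheory GRing.Theory.

(* Words in {f, v}, with f encoded as false and v as true, so that f < v in the
   order of bool.  The word u_{l-1} ... u_0 is the sequence
   [:: u_{l-1}; ...; u_0], so u_j is the j-th item counted from the right. *)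
Definition word := seq bool.
Definition letter_f : bool := false.
Definition letter_v : bool := true.

Definition letter (w : word) (j : nat) : bool := nth letter_f (rev w) j.

Definition wpow (z : word) (n : nat) : word := flatten (nseq n z).

Definition primitive (w : word) : Prop :=
  forall (z : word) (n : nat), 1 < n -> w <> wpow z n.

Definition tau (w : word) : word := rotr 1 w.

Definition wle (u v : word) : bool := ((u : seqlexi bool) <= v)%O.

(* Multisets of words are represented by sequences. *)
Definition lcm_size (W : seq word) : nat := \big[lcmn/1]_(w <- W) size w.

Definition Wtilde (W : seq word) : seq word :=
  [seq wpow (iter j.*2 tau w) (lcm_size W %/ size w)
     | w <- W, j <- [seq j <- iota 0 (size w) | j.*2 < size w]].

Definition q_of (W : seq word) : nat := size (Wtilde W).

Definition omega (W : seq word) (s : nat) : word :=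
  nth [::] (sort wle (Wtilde W)) s.

(* The symmetric group on {1, ..., q} is 'S_q, where the point s is the ordinal
   of value s.-1.  The product g * h in 'S_q is "g first, then h", so a product
   that is composed right to left appears here in the reverse order. *)
Section Symmetric.
Local Open Scope group_scope.

Definition cycle_perm (T : finType) (c : seq T) : {perm T} :=
  perm (can_inj (prev_next (undup_uniq c))).

(* Here z is the increasing sequence [:: z_1.-1; ...; z_b.-1], and the factor of
   index m is the cycle (m.+1, m.+2, ..., z_(m.+1)). *)
Definition gamma_of (q : nat) (z : seq nat) : 'S_q :=
  \prod_(m < size z) cycle_perm [seq i : 'I_q <- enum 'I_q | m <= i <= nth 0 z m].

Definition gamma (W : seq word) : 'S_(q_of W) :=
  gamma_of (q_of W) [seq s <- iota 0 (q_of W) | letter (omega W s) 0 == letter_v].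

Definition simple_reflections (q : nat) : {set 'S_q} :=
  [set tperm u.1 u.2 | u : 'I_q * 'I_q & u.2 == u.1.+1 :> nat].

Lemma simple_reflections_gen q : <<simple_reflections q>> = [set: 'S_q].
Proof.
apply/eqP; rewrite eqEsubset subsetT /=; apply/subsetP => g _.
have [ts -> _] := prod_tpermP g; apply: group_prod => -[x y] _ /=.
suff lt_case n (a b : 'I_q) : b = a + n :> nat -> tperm a b \in <<simple_reflections q>>.
  case: (leqP x y) => [lexy | /ltnW leyx].
    by apply: (lt_case (y - x)%N); rewrite subnKC.
  by rewrite tpermC; apply: (lt_case (x - y)%N); rewrite subnKC.
elim: n b => [|n IHn] b Eb.
  have -> : b = a by apply: val_inj; rewrite /= Eb addn0.
  by rewrite tperm1 group1.
have lt_c : a + n < q by apply: leq_trans (ltn_ord b); rewrite Eb addnS.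
pose c := Ordinal lt_c.
have cb : tperm c b \in <<simple_reflections q>>.
  by apply/mem_gen/imsetP; exists (c, b); rewrite ?inE //= Eb addnS.
have ac : tperm a c \in <<simple_reflections q>> by apply: IHn.
have [-> // | neq_ac] := eqVneq a c.
have neq_ab : a != b by rewrite -val_eqE /= Eb neq_ltn addnS ltnS leq_addr.
suff -> : tperm a b = tperm a c ^ tperm c b by rewrite groupJ.
by rewrite tpermJ tpermL tpermD // eq_sym.
Qed.

Lemma simple_reflections_pow q (g : 'S_q) :
  exists n, g \in simple_reflections q ^+ n.
Proof.
have /gen_prodgP[n [c Sc ->]] : g \in <<simple_reflections q>>.
  by rewrite simple_reflections_gen inE.
exists n; elim: n c Sc => [|n IHn] c Sc; first by rewrite big_ord0 inE.
by rewrite big_ord_recl expgS mem_mulg // IHn.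
Qed.

Definition coxeter_length (q : nat) (g : 'S_q) : nat :=
  ex_minn (simple_reflections_pow g).

(* The reflection s_i = (i, i+1) is the transposition of the ordinals of values
   i.-1 and i. *)
Definition parabolic (a b : nat) : {set 'S_(a + b)} :=
  <<[set tperm u.1 u.2 | u : 'I_(a + b) * 'I_(a + b)
       & (u.2 == u.1.+1 :> nat) && (u.2 != b :> nat)]>>.

Definition min_coset_reps (a b : nat) : {set 'S_(a + b)} :=
  [set g | [forall h in parabolic a b,
              coxeter_length g <= coxeter_length (g * h)]].

End Symmetric.

Section Modules.
Local Open Scope ring_scope.

Variables (k : closedFieldType) (M : vectType k).
Implicit Types (F V : M -> M) (U : {vspace M}).

Record BT1 (p : nat) (F V : M -> M) : Prop := {
  BT1_FD : forall x y, F (x + y) = F x + F y;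
  BT1_FZ : forall c x, F (c *: x) = c ^+ p *: F x;
  BT1_VD : forall x y, V (x + y) = V x + V y;
  BT1_VZ : forall c x, V (c ^+ p *: x) = c *: V x;
  BT1_kerF : forall x, F x = 0 <-> exists y, x = V y;
  BT1_kerV : forall x, V x = 0 <-> exists y, x = F y
}.

(* M_0 and M_1 are Mi false and Mi true. *)
Record unitary_BT1 (p : nat) F V (lam : {skew_symmetric M})
    (Mi : bool -> {vspace M}) : Prop := {
  unitary_BT1_BT1 : BT1 p F V;
  unitary_BT1_symplectic : is_psymplectic lam;
  unitary_BT1_adj : forall x y, lam (F x) y = lam x (V y) ^+ p;
  unitary_BT1_F : forall i x, x \in Mi i -> F x \in Mi (~~ i);
  unitary_BT1_V : forall i x, x \in Mi i -> V x \in Mi (~~ i);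
  unitary_BT1_sum : (Mi false + Mi true)%VS = fullv;
  unitary_BT1_direct : directv (Mi false + Mi true);
  unitary_BT1_lagrangian : forall i, orthov lam (Mi i) = Mi i
}.

(* The dimension of the kernel of the restriction of F to U is n. *)
Definition dim_ker F U (n : nat) : Prop :=
  exists K : {vspace M},
    (forall x, (x \in K) = (x \in U) && (F x == 0)) /\ \dim K = n.

Definition signature F (Mi : bool -> {vspace M}) (a b : nat) : Prop :=
  dim_ker F (Mi true) a /\ dim_ker F (Mi false) b.

(* The subspace N of M, with standard basis e = [:: a_0; ...; a_(l-1)], is a
   copy of the module attached to the word w. *)
Definition word_submodule F V (w : word) (N : {vspace M}) (e : seq M) : Prop :=
  [/\ size e = size w,
      basis_of N e &
      forall j, (j < size w)%N ->
        let a i := nth 0 e (i %% size w) in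
        F (a j) = (if letter w j == letter_f then a j.+1 else 0) /\
        V (a j.+1) = (if letter w j == letter_v then a j else 0)].

Definition preserves (f : M -> M) (B : seq M) : Prop :=
  {in B, forall x, f x \in B \/ f x = 0}.

(* A chain of subspaces indexed by dimension; the 0 subspace is included.
   Stability under F and V^{-1} is a property of the set of its members. *)
Definition final_filtration F V (q : nat) (C : nat -> {vspace M}) : Prop :=
  [/\ forall s, (s <= q.*2)%N -> \dim (C s) = s,
      forall s t, (s <= t <= q.*2)%N -> (C s <= C t)%VS,
      forall s, (s <= q.*2)%N ->
        exists2 t, (t <= q.*2)%N &
          forall y, y \in C t <-> exists2 x, x \in C s & y = F x &
      forall s, (s <= q.*2)%N ->
        exists2 t, (t <= q.*2)%N & forall x, (x \in C t) = (V x \in C s)].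

Definition eta_function F (M0 : {vspace M}) (q : nat) (C : nat -> {vspace M})
    (eta : nat -> nat) : Prop :=
  eta 0%N = 0%N /\
  forall s, (1 <= s <= q)%N ->
    exists t, [/\ (t <= q.*2)%N, \dim (C t :&: M0) = s
                & dim_ker F (C t :&: M0) (eta s)].

(* Moonen's recipe, applied to the filtration C, yields the permutation g. *)
Definition recipe_yields F (M0 : {vspace M}) (q : nat) (C : nat -> {vspace M})
    (g : 'S_q) : Prop :=
  exists2 eta, eta_function F M0 q C eta &
    g = gamma_of q [seq s <- iota 0 q | eta s.+1 == (eta s).+1].

(* Moonen's bijection sends the module to g: there is a choice of final
   filtration, and every choice yields g. *)
Definition moonen_corresponds F V (Mi : bool -> {vspace M}) (a b : nat)
    (g : 'S_(a + b)) : Prop :=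
  [/\ g \in min_coset_reps a b,
      exists C, final_filtration F V (a + b) C &
      forall C, final_filtration F V (a + b) C ->
        recipe_yields F (Mi false) C g].

End Modules.

Arguments moonen_corresponds {k M} F V Mi a b g.

(* Main.v *)
(* On the standard bases of the factors, F and V^-1 move every vector one step
   along its cycle.  Hence each final filtration contains, for every word u, the
   spans of the basis vectors whose preceding letters, read backwards, form a
   word that is <= u, respectively < u.  On M_0 these spans cut out blocks
   indexed by Wtilde, and F is zero or injective on a block according to the last
   letter of its word: thus eta counts the words of Wtilde that end in v.

   If all words are primitive, the basis has a total order that F and V^-1
   respect, and the initial segments span a final filtration.  A factor of word
   zz is first split into two twisted copies of the factor of z.

   Finally, gamma sends {z_1, ..., z_b} onto {1, ..., b} and is a product of
   sum_m (z_m - m) simple reflections.  For every h in the parabolic subgroup,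
   gamma h still inverts all pairs i < z_m with i not among the z's, of which
   there are sum_m (z_m - m); so gamma has minimal length in its coset. *)
Require Import Defs.
From mathcomp Require Import all_boot all_order all_algebra all_fingroup.
From mathcomp Require Import sesquilinear zify.

Set Implicit Arguments.
Unset Strict Implicit.
Unset Printing Implicit Defensive.

Import Order.TTheory GRing.Theory.

(** * Inversions and minimal coset representatives *)

Section InversionCount.
Variable q : nat.
Local Open Scope group_scope.
Implicit Types (g h : 'S_q) (z : seq nat).

Definition inversions g : {set 'I_q * 'I_q} :=
  [set u : 'I_q * 'I_q | (u.1 < u.2) && (g u.2 < g u.1)].

(** The product applies [g] first, so [t] swaps two consecutive values; the only pair that can
    become inverted is the pair of preimages of these two values. *)
Lemma card_inversions_mulr g t : t \in simple_reflections q ->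
  #|inversions (g * t)| <= #|inversions g|.+1.
Proof.
case/imsetP=> -[k k']; rewrite inE /= => /eqP Ek ->.
suff /subset_leq_card : inversions (g * tperm k k')
    \subset (g^-1 k, g^-1 k') |: inversions g.
  by move/leq_trans; apply; rewrite cardsU1; case: (_ \notin _).
apply/subsetP=> -[i j]; rewrite !inE /= !permM xpair_eqE => /andP[ltij].
rewrite ltij /=; case: (ltnP (g j) (g i)) => [_|le_ij]; first by rewrite orbT.
rewrite orbF -(inj_eq (@perm_inj _ g) i) permKV -(inj_eq (@perm_inj _ g) j) permKV.
have: g i != g j by rewrite (inj_eq perm_inj) -val_eqE /= neq_ltn ltij.
rewrite -!val_eqE /=; move: le_ij; case: tpermP => [->|->|/eqP + /eqP];
 case: tpermP => [->|->|/eqP + /eqP]; rewrite -?val_eqE /=; lia.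
Qed.

Lemma card_inversions_pow g n :
  g \in simple_reflections q ^+ n -> #|inversions g| <= n.
Proof.
elim: n g => [|n IHn] g.
  rewrite expg0 => /set1P ->; rewrite leqn0 cards_eq0; apply/eqP/setP=> u.
  by rewrite !inE !perm1; lia.
rewrite expgSr => /mulsgP[h t /IHn le_h St ->].
exact: leq_trans (card_inversions_mulr h St) _.
Qed.

Lemma card_inversions_length g : #|inversions g| <= coxeter_length g.
Proof. by rewrite /coxeter_length; case: ex_minnP => n /card_inversions_pow. Qed.

Lemma coxeter_length_le g n :
  g \in simple_reflections q ^+ n -> coxeter_length g <= n.
Proof. by rewrite /coxeter_length; case: ex_minnP => m _; apply. Qed.

(** This is the factor of index [m] in [gamma_of], where [n] is the entry of [z] at index [m]. *)
Definition interval_cycle m n : 'S_q :=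
  cycle_perm [seq i : 'I_q <- enum 'I_q | m <= i <= n].

Lemma map_val_interval m n : n < q ->
  [seq val i | i <- [seq i : 'I_q <- enum 'I_q | m <= i <= n]] = iota m (n.+1 - m).
Proof.
move=> lt_nq; rewrite -(filter_map _ (fun i => m <= i <= n)) val_enum_ord.
apply: (irr_sorted_eq ltn_trans ltnn); rewrite ?iota_ltn_sorted //.
  by apply: sorted_filter; [apply: ltn_trans | apply: iota_ltn_sorted].
by move=> i; rewrite mem_filter !mem_iota; lia.
Qed.

Lemma interval_cycleE m n (x : 'I_q) : m <= n < q ->
  interval_cycle m n x = (if m <= x < n then x.+1 else if x == n :> nat then m else x) :> nat.
Proof.
move=> /andP[le_mn lt_nq].
have uc : uniq [seq i : 'I_q <- enum 'I_q | m <= i <= n].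
  by apply: filter_uniq; apply: enum_uniq.
(* The injection [val] transports [next] to an interval of natural numbers, where it can be
   computed. *)
rewrite permE undup_id // -[nat_of_ord _]/(val _) -(next_map val_inj uc).
rewrite map_val_interval // -[val x]/(nat_of_ord x).
move: (nat_of_ord x) => {uc} y; rewrite next_nth mem_iota.
have -> : (m <= y < m + (n.+1 - m)) = (m <= y <= n) by lia.
have [le_my|] /= := leqP m y; last by case: ifP => //; lia.
have [le_yn|lt_ny] := leqP y n; last first.
  by case: ifP => [|_]; [lia | case: eqP => //; lia].
rewrite subSn //=.
have [->|ne_ym] := eqVneq m y.
  have [eq_yn|ne_yn] := eqVneq y n; first by rewrite eq_yn subnn ltnn.
  have lt_yn : y < n by lia.
  by rewrite nth_iota /= ?lt_yn; lia.
have lt_my : m < y by lia.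
have -> : index y (iota m.+1 (n - m)) = y - m.+1.
  have {1}-> : y = nth 0 (iota m.+1 (n - m)) (y - m.+1) by rewrite nth_iota; lia.
  by rewrite index_uniq ?iota_uniq ?size_iota //; lia.
have [->|ne_yn] := eqVneq y n.
  by rewrite ltnn nth_default ?size_iota; lia.
have lt_yn : y < n by lia.
by rewrite nth_iota /= ?lt_yn; lia.
Qed.

Lemma interval_cycle_pow m n : m <= n < q ->
  interval_cycle m n \in simple_reflections q ^+ (n - m).
Proof.
move=> /andP[le_mn]; rewrite -{1 2}(subnKC le_mn).
elim: (n - m) => [|d IHd] lt_q.
  rewrite expg0; apply/set1P/permP=> x; apply: ord_inj; rewrite perm1.
  rewrite interval_cycleE; last by lia.
  by case: ifP; [lia|case: eqP; lia].
have lt_q' : m + d < q by lia.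
pose x0 := Ordinal lt_q'; pose x1 := Ordinal lt_q.
(* The longer cycle is the transposition of its last two points followed by the shorter cycle. *)
suff -> : interval_cycle m (m + d.+1) = tperm x0 x1 * interval_cycle m (m + d).
  rewrite expgS mem_mulg ?IHd //; apply/imsetP; exists (x0, x1) => //.
  by rewrite inE /= addnS.
apply/permP=> x; apply: ord_inj; rewrite permM !interval_cycleE; try lia.
by case: tpermP => [->|->|/eqP + /eqP]; rewrite -?val_eqE /=; do ![case: ifP]; lia.
Qed.

(** * The permutation attached to an increasing sequence, and its length *)

Section Gamma.
Variable z : seq nat.
Hypothesis z_sorted : sorted ltn z.
Hypothesis z_bound : all (fun x => x < q) z.

Lemma nth_sorted_ltn i j : i < j < size z -> nth 0 z i < nth 0 z j.
Proof.
by case/andP=> ltij ltj; apply: (sorted_ltn_nth ltn_trans) => //;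
  rewrite inE; apply: ltn_trans ltj.
Qed.

Lemma nth_sorted_bound i : i < size z -> i <= nth 0 z i < q.
Proof.
move=> lti; rewrite (allP z_bound) ?mem_nth // andbT.
elim: i lti => // i IHi lti; apply: leq_ltn_trans (IHi _) _; first exact: ltnW.
by apply: nth_sorted_ltn; rewrite ltnSn.
Qed.

Lemma gamma_of_pow :
  gamma_of q z \in simple_reflections q ^+ (\sum_(m < size z) (nth 0 z m - m)).
Proof.
rewrite /gamma_of; elim/big_rec2: _ => [|m n g _ IH]; first by rewrite expg0 inE.
by rewrite expgnDr mem_mulg // interval_cycle_pow ?nth_sorted_bound.
Qed.

(** The third clause carries the induction: the entry of index [k] exceeds the earlier ones, so it
    is still in place when the factor of index [k] acts and sends it to [k]. That factor raises by
    one the values from [k] up to this entry, and leaves the values below [k] alone. *)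
Lemma gamma_of_partial k (x : 'I_q) : k <= size z ->
  let g := \prod_(m < k) interval_cycle m (nth 0 z m) in
  [/\ val x \in take k z -> g x < k,
      val x \notin take k z -> k <= g x
    & (forall m, m < k -> nth 0 z m < x) -> g x = x].
Proof.
elim: k x => [|k IHk] x lek /=.
  by rewrite big_ord0 take0 perm1.
rewrite big_ord_recr /= permM.
set g := \prod_(m < k) _; have {IHk} gP y :
    [/\ val y \in take k z -> g y < k, val y \notin take k z -> k <= g y
    & (forall m, m < k -> nth 0 z m < y) -> g y = y] := IHk y (ltnW lek).
have bnd := nth_sorted_bound lek.
have fixg (y : 'I_q) : val y = nth 0 z k -> g y = y.
  move=> Ey; have [_ _] := gP y; apply=> m ltm.
  by rewrite -[nat_of_ord y]/(val y) Ey nth_sorted_ltn // ltm.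
rewrite (take_nth 0) // mem_rcons inE negb_or.
have [Ex|nEx] := eqVneq (val x) (nth 0 z k).
  have gx_x : g x = x by apply: fixg.
  have gx_m : interval_cycle k (nth 0 z k) x = k :> nat.
    by rewrite interval_cycleE // -Ex /= ltnn eqxx andbF.
  split=> //; first by rewrite gx_x gx_m.
  by move/(_ k (ltnSn k)); rewrite -Ex ltnn.
have [g1 g2 g3] := gP x; split=> /=.
- by move/g1 => lt_gx; rewrite interval_cycleE //; do ![case: ifP]; lia.
- move/g2 => lekx; rewrite interval_cycleE //; case: ifP; first by lia.
  case: eqP => [Egx|]; last by lia.
  (* The entry of index [k] is fixed by [g], so by injectivity no other point has this value. *)
  case/eqP: nEx; pose y : 'I_q := Ordinal (proj2 (andP bnd)).
  suff -> : x = y by [].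
  by apply: (@perm_inj _ g); rewrite [RHS]fixg //; apply: ord_inj.
move=> gt_x; have gtk := gt_x k (ltnSn k); apply: ord_inj.
rewrite interval_cycleE // g3; last by move=> m ltm; apply: gt_x; apply: ltnW.
by do ![case: ifP]; lia.
Qed.

Lemma gamma_of_ltn (x : 'I_q) : (gamma_of q z x < size z) = (val x \in z).
Proof.
have [g1 g2 _] := gamma_of_partial x (leqnn _); rewrite take_size in g1 g2.
rewrite /gamma_of; apply/idP/idP=> [|/g1 //]; apply: contraLR => /g2.
by rewrite -leqNgt.
Qed.

(** A point outside [z] followed by a point of [z] is always inverted, because the images lie on
    either side of [size z]. The entry of index [m] has enough such partners, since only the [m]
    earlier entries of [z] lie below it. *)
Lemma sum_le_inversions g :
  (forall x : 'I_q, (g x < size z) = (val x \in z)) ->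
  \sum_(m < size z) (nth 0 z m - m) <= #|inversions g|.
Proof.
move=> gP; pose X := [set u : 'I_q * 'I_q | [&& u.1 < u.2, val u.1 \notin z & val u.2 \in z]].
have /subset_leq_card : X \subset inversions g.
  apply/subsetP=> -[i j]; rewrite !inE /= -!gP => /and3P[-> + ltj]; rewrite -leqNgt.
  exact: leq_trans.
apply: leq_trans.
have uz : uniq z by apply: sorted_uniq z_sorted; [apply: ltn_trans | apply: ltnn].
(* Writing [m] as the index of an entry lets the sum run over the points of [z]. *)
have -> : \sum_(m < size z) (nth 0 z m - m) = \sum_(x <- z) (x - index x z).
  by rewrite [RHS](big_nth 0) big_mkord; apply: eq_bigr => m _; rewrite index_uniq.
rewrite (perm_big [seq val i | i <- enum 'I_q & val i \in z]); last first.
  apply: uniq_perm => //; first by rewrite (map_inj_uniq val_inj) filter_uniq ?enum_uniq.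
  move=> x; apply/idP/mapP => [zx|[i]]; last by rewrite mem_filter => /andP[? _] ->.
  by exists (Ordinal (allP z_bound _ zx)); rewrite // mem_filter zx mem_enum.
rewrite big_map big_filter big_enum_cond /=.
have -> : #|X| = \sum_(j < q | val j \in z) #|[set i : 'I_q | (i < j) && (val i \notin z)]|.
  rewrite (eq_bigr (fun j : 'I_q => \sum_(i : 'I_q | (i < j) && (val i \notin z)) 1)); last first.
    by move=> j _; rewrite -sum1_card; apply: eq_bigl => i; rewrite inE.
  rewrite (exchange_big_dep (fun i : 'I_q => val i \notin z)) /= => [|i j _ /andP[]//].
  rewrite pair_big_dep /= -sum1_card; apply: eq_bigl => -[i j].
  by rewrite inE /=; case: (val i \in z); case: (val j \in z); case: (i < j).
apply: leq_sum => j zj; rewrite leq_subLR.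
have Ej : #|[set i : 'I_q | i < j]| = val j.
  rewrite -sum1_card (eq_bigl (fun i : 'I_q => i < j)) => [|i]; last by rewrite inE.
  have := @big_ord_widen _ _ addn j q (fun=> 1%N) (ltnW (ltn_ord j)) => /= <-.
  by rewrite sum1_card card_ord.
(* Of the points below [j], those in [z] occur among the first [index (val j) z] entries, because
   [z] is increasing. *)
rewrite -{1}Ej -(cardsID [set i : 'I_q | val i \in z]) leq_add //; last first.
  by rewrite subset_leq_card //; apply/subsetP=> i; rewrite !inE andbC.
rewrite cardE -(size_map val) -[leqRHS](_ : size (take (index (val j) z) z) = _); last first.
  by rewrite size_takel // ltnW ?index_mem.
apply: uniq_leq_size; first by rewrite (map_inj_uniq val_inj) enum_uniq.
move=> x /mapP[i]; rewrite mem_enum !inE => /andP[ltij zi] ->.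
rewrite in_take // ltnNge; apply: contraL ltij; rewrite -leqNgt leq_eqVlt.
case/predU1P=> [Eij|lt_idx].
  suff -> : j = i by [].
  by apply: val_inj; rewrite -(nth_index 0 zi) -Eij nth_index.
have := nth_sorted_ltn (_ : index (val j) z < index (val i) z < size z).
by rewrite !nth_index // lt_idx index_mem zi => /(_ isT)/ltnW.
Qed.

End Gamma.

End InversionCount.

(** The omitted reflection is the only one that moves a point across the boundary between [b - 1]
    and [b], so every generator stabilises the set of points below [b]. *)
Lemma parabolic_ltn a b (h : 'S_(a + b)) (x : 'I_(a + b)) :
  h \in parabolic a b -> (h x < b) = (x < b).
Proof.
have sub : parabolic a b \subset 'N([set y : 'I_(a + b) | y < b] | 'P)%g.
  rewrite gen_subG; apply/subsetP=> t /imsetP[[i j]]; rewrite inE /= => /andP[/eqP Ej neb] ->.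
  apply/astabsP=> y /=; rewrite !inE /= apermE.
  by case: tpermP => [->|->|//]; move: neb; rewrite Ej; lia.
by move/(subsetP sub)/astabsP/(_ x); rewrite !inE /= apermE.
Qed.

Lemma gamma_of_min_coset_reps a b z : sorted ltn z ->
  all (fun x => x < a + b) z -> size z = b ->
  gamma_of (a + b) z \in min_coset_reps a b.
Proof.
move=> z_sorted z_bound size_z; rewrite inE; apply/forall_inP=> h hP.
apply: leq_trans (coxeter_length_le (gamma_of_pow z_sorted z_bound)) _.
apply: leq_trans (card_inversions_length _).
apply: sum_le_inversions => // x.
(* Here [h] acts last, on the values, and does not change whether a value is below [b]. *)
by rewrite -(gamma_of_ltn z_sorted z_bound) permM size_z (parabolic_ltn _ hP).
Qed.

(** * Words and cyclic positions *)

Lemma size_wpow z n : size (wpow z n) = n * size z.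
Proof. by elim: n => //= n IHn; rewrite size_cat IHn mulSn. Qed.

Lemma nth_wpow z n k : k < n * size z ->
  nth letter_f (wpow z n) k = nth letter_f z (k %% size z).
Proof.
elim: n k => //= n IHn k; rewrite mulSn nth_cat => ltk.
case: ltnP => [ltkz|lezk]; first by rewrite modn_small.
rewrite IHn; last by rewrite ltn_subLR.
by rewrite -[in RHS](subnKC lezk) modnDl.
Qed.

Lemma cons_wpow_rcons v a n :
  a :: wpow (rcons v a) n = rcons (wpow (a :: v) n) a.
Proof.
elim: n => // n IHn.
by rewrite /wpow /= -!/(wpow _ n) cat_rcons IHn -rcons_cat.
Qed.

Lemma tau_wpow v n : v <> [::] -> tau (wpow v n) = wpow (tau v) n.
Proof.
case/lastP: v => // v a _; rewrite /tau rotr1_rcons.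
have := cons_wpow_rcons v a n; case/lastP: (wpow (rcons v a) n) => [|x b].
  by case: (wpow _ n) => //= ? ? [_]; case: (X in rcons X).
by rewrite rotr1_rcons -rcons_cons => /rcons_inj[<- ->].
Qed.

(** Extended periodically, the letters have the periods [d] and [size w], hence by Bezout also their
    gcd; the word is then a power of its prefix of that length. *)
Lemma rot_not_primitive w d : 0 < d < size w -> rot d w = w -> ~ primitive w.
Proof.
move=> /andP[d_gt0 lt_d] rot_w prim_w.
have l_gt0 : 0 < size w by apply: leq_trans lt_d.
pose c k := nth letter_f w (k %% size w).
have c_d k : c (k + d) = c k.
  rewrite /c -modnDml; move: (k %% size w) (ltn_pmod k l_gt0) => {}k ltk.
  rewrite -[in RHS]rot_w /rot nth_cat nth_drop size_drop; case: ltnP => lek.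
    by rewrite modn_small; [rewrite addnC|lia].
  rewrite nth_take; last by lia.
  have -> : k + d = (k - (size w - d)) + size w by lia.
  by rewrite modnDr modn_small //; lia.
have c_dn n k : c (k + n * d) = c k.
  by elim: n => [|n IHn]; rewrite ?addn0 // mulSnr addnA c_d.
have [u v Euv _] := egcdnP (size w) d_gt0; set g := gcdn d (size w) in Euv.
have c_g k : c (k + g) = c k.
  by rewrite -(c_dn u k) Euv addnCA /c modnMDl.
have c_gn n k : c (k + n * g) = c k.
  by elim: n => [|n IHn]; rewrite ?addn0 // mulSnr addnA c_g.
have g_gt0 : 0 < g by rewrite gcdn_gt0 d_gt0.
have g_dvd : g %| size w by apply: dvdn_gcdr.
have lt_g : g < size w by apply: leq_ltn_trans lt_d; apply: dvdn_leq (dvdn_gcdl _ _).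
have size_g : size (take g w) = g by rewrite size_takel // ltnW.
apply: (prim_w (take g w) (size w %/ g)); first by rewrite ltn_divRL // mul1n.
apply: (@eq_from_nth _ letter_f) => [|k ltk].
  by rewrite size_wpow size_g divnK.
rewrite nth_wpow size_g ?divnK // nth_take ?ltn_mod //.
have lt_r : k %% g < size w by apply: ltn_trans (ltn_pmod _ g_gt0) lt_g.
have := c_gn (k %/ g) (k %% g).
by rewrite addnC -divn_eq /c (modn_small ltk) (modn_small lt_r).
Qed.

(** * Positions on the cycles and the letters that precede them *)

Section Positions.
Variables (I : finType) (w : I -> word).

(** A pair of [i] and [j] indexes the standard basis vector [a_j] of the factor of index [i]. *)
Definition position := {i : I & 'I_(size (w i))}.
Definition pos i (j : 'I_(size (w i))) : position :=
  Tagged (fun i => 'I_(size (w i))) j.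
Definition next_pos (x : position) : position := pos (ordS (tagged x)).
Definition prev_pos (x : position) : position := pos (ord_pred (tagged x)).
(** The letter [u_j] labels the step from [a_j] to [a_(j+1)], so this is the letter of the step out
    of [x]; the step into [x] carries the letter at [prev_pos x]. *)
Definition letter_at (x : position) : bool := letter (w (tag x)) (tagged x).

(* The letters that precede x on its cycle, the most recent one first. *)
Fixpoint past n x : word :=
  if n is n'.+1 then letter_at (prev_pos x) :: past n' (prev_pos x) else [::].

Lemma next_posK : cancel next_pos prev_pos.
Proof. by case=> i j; rewrite /next_pos /prev_pos /= ordSK. Qed.

Lemma prev_posK : cancel prev_pos next_pos.
Proof. by case=> i j; rewrite /next_pos /prev_pos /= ord_predK. Qed.

Lemma next_pos_inj : injective next_pos.
Proof. exact: can_inj next_posK. Qed.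

Lemma iter_next_posK n : cancel (iter n next_pos) (iter n prev_pos).
Proof. by elim: n => // n IHn x; rewrite iterSr /= next_posK IHn. Qed.

Lemma iter_next_pos i (j k : 'I_(size (w i))) n :
  (j + n) %% size (w i) = k -> iter n next_pos (pos j) = pos k.
Proof.
move=> Ek; have {}Ek : val k = ((j + n) %% size (w i))%N by [].
elim: n k Ek => [|n IHn] k Ek.
  by congr pos; apply: val_inj; rewrite Ek addn0 modn_small.
have lt_n : (j + n) %% size (w i) < size (w i).
  by rewrite ltn_mod; apply: leq_ltn_trans (ltn_ord j).
rewrite /= (IHn (Ordinal lt_n)) //; congr pos; apply: val_inj.
by rewrite Ek /= addnS -addn1 modnDml addn1.
Qed.

Lemma iter_next_size x n : size (w (tag x)) %| n -> iter n next_pos x = x.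
Proof.
by case: x => i j /= /dvdnP[k ->]; apply: iter_next_pos; rewrite addnC modnMDl modn_small.
Qed.

Lemma size_past n x : size (past n x) = n.
Proof. by elim: n x => //= n IHn x; rewrite IHn. Qed.

Lemma past_next n x : past n.+1 (next_pos x) = letter_at x :: past n x.
Proof. by rewrite /= next_posK. Qed.

Lemma past_cat m n x : past (m + n) x = past m x ++ past n (iter m prev_pos x).
Proof. by elim: m x => //= m IHm x; rewrite IHm -iterSr. Qed.

Lemma past_iter_next m n x :
  past (m + n) (iter m next_pos x) = past m (iter m next_pos x) ++ past n x.
Proof. by rewrite past_cat iter_next_posK. Qed.

Section Period.
Variable L : nat.
Hypotheses (L_gt0 : 0 < L) (L_dvd : forall i, size (w i) %| L).

(** As [L] is a multiple of the length of the cycle, the oldest of the [L] letters is the one on the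
    step out of [x]. Thus the last letter of the past decides whether [F] kills the vector. *)
Lemma past_rcons x : past L x = rcons (past L.-1 x) (letter_at x).
Proof.
have E : L = L.-1 + 1 by rewrite addn1 prednK.
rewrite {1}E past_cat /= -cats1; congr (_ ++ [:: letter_at _]).
by rewrite -iterS prednK // -[in LHS](iter_next_size (L_dvd (tag x))) iter_next_posK.
Qed.

Lemma past_next_tau x : past L (next_pos x) = tau (past L x).
Proof. by rewrite [in RHS]past_rcons /tau rotr1_rcons -{1}(prednK L_gt0) past_next. Qed.

Lemma past_iter_tau n x : past L (iter n next_pos x) = iter n tau (past L x).
Proof. by elim: n => //= n <-; rewrite past_next_tau. Qed.

Lemma letter_past x : letter (past L x) 0 = letter_at x.
Proof. by rewrite past_rcons /letter rev_rcons. Qed.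

(** Before the cycle wraps around, the letters read backwards are [u_j], ..., [u_0], a suffix of the
    word. *)
Lemma past_next_pos i (j : 'I_(size (w i))) :
  past j.+1 (next_pos (pos j)) = drop (size (w i) - j.+1) (w i).
Proof.
case: j => j; elim: j => [|j IHj] ltj; rewrite past_next /letter_at /letter;
  set u := past _ _; rewrite /=.
  rewrite nth_rev //= (drop_nth letter_f); last by rewrite subn1 ltn_predL.
  by rewrite subn1 prednK // drop_size.
rewrite nth_rev // (drop_nth letter_f (n := size (w i) - j.+2)) ?ltn_subrL //=; last first.
  by rewrite (leq_trans _ ltj).
congr (_ :: _); have ltj' : j < size (w i) by apply: ltnW.
rewrite subnSK // -IHj /u; congr past.
apply/esym/(iter_next_pos (n := 1)); rewrite /= addn1 modn_small //.
Qed.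

Lemma past_size i (j : 'I_(size (w i))) : j = 0 :> nat ->
  past (size (w i)) (pos j) = w i.
Proof.
move=> j0; have l_gt0 := leq_ltn_trans (leq0n _) (ltn_ord j).
have lt_l : (size (w i)).-1 < size (w i) by rewrite ltn_predL.
have -> : pos j = next_pos (pos (Ordinal lt_l)).
  by apply/esym/(iter_next_pos (n := 1)); rewrite /= addn1 prednK // modnn.
by rewrite -{1}(prednK l_gt0) (past_next_pos (Ordinal lt_l)) /= prednK // subnn drop0.
Qed.

(** This identifies the pasts with the words that make up [Wtilde]: at index 0 the past is a power
    of the word itself, and each step forward rotates it. *)
Lemma past_wpow i (j : 'I_(size (w i))) :
  past L (pos j) = wpow (iter j tau (w i)) (L %/ size (w i)).
Proof.
have l_gt0 := leq_ltn_trans (leq0n _) (ltn_ord j).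
pose o := Ordinal l_gt0.
have -> : pos j = iter j next_pos (pos o).
  by apply/esym/iter_next_pos; rewrite /= add0n modn_small.
rewrite past_iter_tau; have -> : past L (pos o) = wpow (w i) (L %/ size (w i)).
  rewrite -{1}(divnK (L_dvd i)); elim: (_ %/ _) => //= n IHn.
  rewrite mulSn -{1}(@iter_next_size (pos o) (size (w i))) // past_iter_next.
  by rewrite iter_next_size //= IHn past_size.
elim: (nat_of_ord j) => //= n ->.
rewrite tau_wpow // => /(congr1 size); rewrite /= => E.
have size_iter m : size (iter m tau (w i)) = size (w i).
  by elim: m => //= m IHm; rewrite size_rotr.
by have := l_gt0; rewrite -(size_iter n) E.
Qed.

(** Advancing both positions until the first reaches index 0 keeps the pasts equal. If the second
    were then at a nonzero index, the word would be fixed by a proper rotation. *)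
Lemma past_primitive_inj i (j j' : 'I_(size (w i))) :
  primitive (w i) -> past L (pos j) = past L (pos j') -> j = j'.
Proof.
wlog lejj : j j' / j <= j'.
  by move=> IH prim E; case/orP: (leq_total j j') => /IH; [|move/(_ prim (esym E))]; auto.
move=> prim E; apply: val_inj; apply/eqP; rewrite eqn_leq lejj /= leqNgt.
apply/negP=> ltjj; set l := size (w i).
have l_gt0 : 0 < l := leq_ltn_trans (leq0n _) (ltn_ord j).
have lt_d : j' - j < l by apply: leq_ltn_trans (ltn_ord j'); apply: leq_subr.
have ltjl := ltn_ord j; rewrite -/l in ltjl.
have Ej : iter (l - j) next_pos (pos j) = pos (Ordinal l_gt0).
  by apply: iter_next_pos; rewrite subnKC ?modnn // (ltnW ltjl).
have Ej' : iter (l - j) next_pos (pos j') = pos (Ordinal lt_d).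
  apply: iter_next_pos => /=; rewrite addnBA ?(ltnW ltjl) // addnC -addnBA // addnC.
  by rewrite modnDr modn_small.
have {E} : past L (pos (Ordinal l_gt0)) = past L (pos (Ordinal lt_d)).
  by rewrite -Ej -Ej' !past_iter_tau E.
have [n En] : exists n, L = l + n.
  by exists (L - l); rewrite subnKC // dvdn_leq // L_dvd.
rewrite En !past_cat => /eqP; rewrite eqseq_cat ?size_past // => /andP[/eqP + _].
(* At index [d = j' - j] the past of length [l] is the suffix of length [d] followed by the rest of
   the word, which is the rotation by [l - d]. *)
rewrite past_size // => E; apply: (@rot_not_primitive (w i) (l - (j' - j))) prim.
  by rewrite subn_gt0 lt_d ltn_subrL l_gt0 subn_gt0 ltjj.
rewrite [RHS]E /rot; have lt_d1 : (j' - j).-1 < l by exact: leq_ltn_trans (leq_pred _) lt_d.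
have d_gt0 : 0 < j' - j by rewrite subn_gt0.
have Ed : pos (Ordinal lt_d) = next_pos (pos (Ordinal lt_d1)).
  by apply/esym/(iter_next_pos (n := 1)); rewrite /= addn1 prednK ?modn_small.
rewrite -[X in _ = past X _](subnKC (ltnW lt_d)) past_cat; congr (_ ++ _).
  by rewrite Ed -{2}(prednK d_gt0) (past_next_pos (Ordinal lt_d1)) /= prednK.
have -> : iter (j' - j) prev_pos (pos (Ordinal lt_d)) = pos (Ordinal l_gt0).
  rewrite -[RHS](iter_next_posK (j' - j)); congr (iter _ _ _).
  by apply/esym/iter_next_pos; rewrite /= modn_small.
have Ew : w i = past l (pos (Ordinal l_gt0)) by rewrite past_size.
rewrite [X in take _ X]Ew -[X in take _ (past X _)](subnK (ltnW lt_d)) past_cat.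
by rewrite take_size_cat // size_past.
Qed.

End Period.

End Positions.

(** * The multiset [Wtilde] in terms of positions *)

Lemma lcm_size_gt0 (W : seq word) :
  (forall w, w \in W -> w <> [::]) -> 0 < lcm_size W.
Proof.
rewrite /lcm_size; elim: W => [|w W IHW] W0; first by rewrite big_nil.
rewrite big_cons lcmn_gt0 IHW => [|v Wv]; last by apply: W0; rewrite inE Wv orbT.
by rewrite andbT lt0n size_eq0; apply/eqP/W0/mem_head.
Qed.

Lemma dvdn_lcm_size (W : seq word) w : w \in W -> size w %| lcm_size W.
Proof.
rewrite /lcm_size; elim: W => // v W IHW; rewrite inE big_cons.
by case/predU1P=> [->|/IHW]; [apply: dvdn_lcml | move/dvdn_trans; apply; apply: dvdn_lcmr].
Qed.

(** Doubling matches the indices used in [Wtilde] with the even positions of a word. *)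
Lemma count_even_iota l (Q : pred nat) :
  count (fun j => (j.*2 < l) && Q j.*2) (iota 0 l) = #|[set j : 'I_l | ~~ odd j & Q j]|.
Proof.
rewrite cardE -(size_map val) -size_filter -(size_map double); apply: perm_size.
apply: uniq_perm.
- by rewrite (map_inj_uniq double_inj) filter_uniq ?iota_uniq.
- by rewrite (map_inj_uniq val_inj) enum_uniq.
move=> n; apply/mapP/mapP=> [[j]|[j]].
  rewrite mem_filter => /andP[/andP[lt_j Qj] _] ->; exists (Ordinal lt_j) => //.
  by rewrite mem_enum inE /= odd_double.
rewrite mem_enum inE => /andP[ej Qj] ->; have Ej := even_halfK ej.
exists (val j)./2; last by rewrite Ej.
by rewrite mem_filter Ej ltn_ord Qj mem_iota /=; have := ltn_ord j; rewrite -{1}Ej; lia.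
Qed.

(** [Wtilde] is the multiset of the pasts at even positions, which later turn out to index the basis
    of [M_0]. Counting all predicates expresses this with multiplicities and without an order. *)
Lemma count_Wtilde (W : seq word) (P : pred word) :
  let w (i : 'I_(size W)) := nth [::] W i in
  (forall v, v \in W -> v <> [::]) ->
  count P (Wtilde W) = #|[set x : position w | ~~ odd (tagged x) & P (past (lcm_size W) x)]|.
Proof.
move=> w W0; rewrite /Wtilde count_flatten sumnE big_map big_map (big_nth [::]) big_mkord.
under eq_bigr => i _ do rewrite count_map count_filter.
transitivity (\sum_i \sum_(j < size (w i) | ~~ odd j && P (past (lcm_size W) (pos j))) 1);
  last first.
  by rewrite sig_big_dep -sum1_card; apply: eq_bigl => -[i j]; rewrite inE.
apply: eq_bigr => i _; rewrite sum1_card.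
pose f n := wpow (iter n tau (w i)) (lcm_size W %/ size (w i)).
transitivity (count (fun j => (j.*2 < size (w i)) && (P \o f) j.*2) (iota 0 (size (w i)))).
  by apply: eq_count => j; rewrite /= andbC.
rewrite (count_even_iota _ (P \o f)); apply: eq_card => j; rewrite !inE /=.
congr (_ && P _); apply/esym/past_wpow; first exact: lcm_size_gt0.
by move=> i'; apply/dvdn_lcm_size/mem_nth.
Qed.

(** * The lexicographic order *)

Lemma wle_total : total wle.
Proof. by move=> u v; apply: le_total. Qed.

Lemma wle_trans : transitive wle.
Proof. by move=> v u w; apply: le_trans. Qed.

Lemma wle_anti : antisymmetric wle.
Proof. by move=> u v; apply: le_anti. Qed.

Lemma wle_refl : reflexive wle.
Proof. by move=> u; apply: lexx. Qed.

Definition wlt (u v : word) : bool := ~~ wle v u.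

(** This recursion, shared with [wlt], is the property of a relation that [final_filtration_past]
    relies on. *)
Lemma wle_cons a b u v : wle (a :: u) (b :: v) = (a < b)%O || (a == b) && wle u v.
Proof. rewrite /wle lexi_cons. by case: a; case: b. Qed.

Lemma wlt_trans v u t : wlt u v -> wlt v t -> wlt u t.
Proof.
rewrite /wlt => nvu; apply: contra => /wle_trans; apply.
by case/orP: (wle_total u v) nvu => [|->].
Qed.

Lemma wlt_cons a b u v : wlt (a :: u) (b :: v) = (a < b)%O || (a == b) && wlt u v.
Proof. by rewrite /wlt wle_cons; case: a; case: b. Qed.

Lemma wlt_rcons a u v : size u = size v -> wlt (rcons u a) (rcons v a) = wlt u v.
Proof.
elim: u v => [|b u IHu] [|c v] //= => [_|[/IHu E]]; last by rewrite !wlt_cons E.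
by rewrite /wlt !/wle !lexx.
Qed.

(** Copies of the word of index [s] fail [P], so it does not matter how many of them fall into the
    initial segment: only the strictly smaller words contribute, and all of these lie in it. *)
Lemma count_take_sorted s (S : seq word) (P : pred word) :
  sorted wle S -> s < size S -> ~~ P (nth [::] S s) ->
  count P (take s.+1 S) = count (predI P (fun v => wlt v (nth [::] S s))) S.
Proof.
move=> S_sorted ltsS nPs; set u := nth [::] S s in nPs *.
have le_nth i j : i <= j -> j < size S -> wle (nth [::] S i) (nth [::] S j).
  move=> leij ltj; apply: (sorted_leq_nth wle_trans) => //; rewrite ?inE //.
  - by move=> v; apply: lexx.
  - exact: leq_ltn_trans ltj.
rewrite -{2}(cat_take_drop s.+1 S) count_cat -[LHS]addn0; congr (_ + _).
  apply: eq_in_count => v /(nthP [::])[i]; rewrite size_takel // => lti <- /=.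
  rewrite nth_take //; have [->|neq] := eqVneq (nth [::] S i) u.
    by rewrite (negbTE nPs).
  rewrite /wlt; case: (boolP (wle u _)) => [le_u|]; last by rewrite andbT.
  by case/eqP: neq; apply: wle_anti; rewrite le_u le_nth // -ltnS.
apply/esym/eqP; rewrite -leqn0 leqNgt -has_count; apply/hasPn=> v /(nthP [::])[i].
rewrite size_drop => lti <-; rewrite /= /wlt nth_drop negb_and negbK.
suff -> : wle u (nth [::] S (s.+1 + i)) by rewrite orbT.
by apply: le_nth; [lia | rewrite -ltn_subRL].
Qed.

(** * Bases permuted by F and V up to scalars *)

Section MonomialBasis.
Local Open Scope ring_scope.
Variables (k : closedFieldType) (M : vectType k) (T : finType) (d : T -> M).
Hypotheses (d_span : <<codom d>>%VS = fullv) (card_T : #|T| = \dim {:M}).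
Implicit Types (A : {set T}) (v : M).

Let d_free : free (codom d).
Proof. by rewrite /free d_span size_codom card_T. Qed.

Definition coordinate (x : T) v : k := coord (codom_tuple d) (enum_rank x) v.

Lemma coordinate0 x : coordinate x 0 = 0.
Proof. exact: linear0. Qed.

Lemma coordinateZ x a v : coordinate x (a *: v) = a * coordinate x v.
Proof. exact: linearZ. Qed.

Lemma coordinate_bigsum (I : finType) (P : pred I) (f : I -> M) x :
  coordinate x (\sum_(i | P i) f i) = \sum_(i | P i) coordinate x (f i).
Proof. exact: linear_sum. Qed.

Lemma coordinate_basis x y : coordinate x (d y) = (x == y)%:R.
Proof.
rewrite /coordinate; have -> : d y = (codom_tuple d)`_(enum_rank y).
  by rewrite (nth_codom _ _ (enum_rank y)) enum_rankK.
by rewrite coord_free // (inj_eq enum_rank_inj) eq_sym.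
Qed.

Lemma coordinate_sum v : v = \sum_x coordinate x v *: d x.
Proof.
have {1}-> := @coord_span _ _ _ (codom_tuple d) v _; last by rewrite d_span memvf.
rewrite (reindex_onto (@enum_rank T) (@enum_val T T)) /=; last by move=> i _; apply: enum_valK.
apply: eq_big => [x|x _]; first by rewrite enum_rankK eqxx.
by rewrite (nth_codom _ _ (enum_rank x)) enum_rankK.
Qed.

Lemma coordinate_eq u v : (forall x, coordinate x u = coordinate x v) -> u = v.
Proof.
by move=> E; rewrite (coordinate_sum u) (coordinate_sum v); apply: eq_bigr => x _; rewrite E.
Qed.

Lemma coordinate_comb (P : pred T) (c : T -> k) x :
  coordinate x (\sum_(y | P y) c y *: d y) = if P x then c x else 0.
Proof.
rewrite coordinate_bigsum; case: ifP => Px.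
  rewrite (bigD1 x) //= coordinateZ coordinate_basis eqxx /= mulr1 big1 ?addr0 // => y.
  by case/andP=> _ /negbTE ne; rewrite coordinateZ coordinate_basis eq_sym ne /= mulr0.
rewrite big1 // => y Py; rewrite coordinateZ coordinate_basis.
by case: eqP Py => [<-|]; rewrite ?Px //= mulr0.
Qed.

Definition spanned A : {vspace M} := (\sum_(x in A) <[d x]>)%VS.

Lemma mem_spanned A v :
  reflect (forall x, x \notin A -> coordinate x v = 0) (v \in spanned A).
Proof.
apply: (iffP idP) => [/memv_sumP[u uP ->] x nAx|v0].
  rewrite coordinate_bigsum big1 // => y Ay; have /vlineP[c ->] := uP y Ay.
  by rewrite coordinateZ coordinate_basis; case: eqP nAx => [->|]; rewrite ?Ay //= mulr0.
rewrite (coordinate_sum v); apply: memv_suml => x _.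
have [Ax|/v0->] := boolP (x \in A); last by rewrite scale0r mem0v.
by apply: memvZ; apply: (subvP (sumv_sup x Ax (subvv _))); apply: memv_line.
Qed.

Lemma spanned_capv A A' : (spanned A :&: spanned A')%VS = spanned (A :&: A').
Proof.
apply/vspaceP=> v; rewrite memv_cap.
apply/andP/mem_spanned => [[/mem_spanned vA /mem_spanned vA'] x|vAA].
  by rewrite inE negb_and => /orP[/vA|/vA'].
by split; apply/mem_spanned=> x nx; apply: vAA; rewrite inE negb_and nx ?orbT.
Qed.

Lemma spanned_addv A A' : (spanned A + spanned A')%VS = spanned (A :|: A').
Proof.
apply/eqP; rewrite eqEsubv; apply/andP; split.
  rewrite subv_add; apply/andP; split; apply/subvP=> v /mem_spanned v0;
  by apply/mem_spanned=> x; rewrite inE negb_or => /andP[n1 n2]; apply: v0.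
apply/subv_sumP=> x; rewrite inE => /orP[] Ax.
  exact: subv_trans (sumv_sup x Ax (subvv _)) (addvSl _ _).
exact: subv_trans (sumv_sup x Ax (subvv _)) (addvSr _ _).
Qed.

Lemma spannedS A A' : A \subset A' -> (spanned A <= spanned A')%VS.
Proof.
move/subsetP=> sAA; apply/subvP=> v /mem_spanned v0; apply/mem_spanned=> x nA'x.
by apply: v0; apply: contra nA'x; apply: sAA.
Qed.

Lemma spanned0 : spanned set0 = 0%VS.
Proof. by rewrite /spanned big_set0. Qed.

Lemma spannedT : spanned setT = fullv.
Proof.
by apply/vspaceP=> v; rewrite memvf; apply/mem_spanned => x; rewrite inE.
Qed.

(** The vectors indexed by [A], followed by the remaining ones, form a permutation of the basis. *)
Lemma dim_spanned A : \dim (spanned A) = #|A|.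
Proof.
have -> : spanned A = <<[seq d x | x in A]>>%VS by rewrite span_def big_map big_enum.
rewrite (eqP (_ : free _)) ?size_image //.
apply: (@catl_free _ _ [seq d x | x <- enum T & x \notin A]).
have -> : [seq d x | x in A] = [seq d x | x <- enum T & x \in A].
  by rewrite enumT.
by rewrite -map_cat (perm_free (perm_map d (permEl (perm_filterC _ _)))).
Qed.

End MonomialBasis.

(** * Images under F, preimages under V and the kernel of F on coordinate subspaces *)

Section MonomialBT1.
Local Open Scope ring_scope.
Variables (k : closedFieldType) (p : nat) (M : vectType k) (F V : M -> M).
Hypotheses (p_gt0 : (0 < p)%N) (FV : BT1 p F V).

Lemma BT1_F_sum (T : finType) (d : T -> M) (c : T -> k) :
  F (\sum_x c x *: d x) = \sum_x c x ^+ p *: F (d x).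
Proof.
have F0 : F 0 = 0 by apply: (@addrI _ (F 0)); rewrite -(BT1_FD FV) !addr0.
by rewrite (big_morph F (BT1_FD FV) F0); apply: eq_bigr => x _; rewrite (BT1_FZ FV).
Qed.

Lemma BT1_V_sum (T : finType) (d : T -> M) (c : T -> k) :
  V (\sum_x c x ^+ p *: d x) = \sum_x c x *: V (d x).
Proof.
have V0 : V 0 = 0 by apply: (@addrI _ (V 0)); rewrite -(BT1_VD FV) !addr0.
by rewrite (big_morph V (BT1_VD FV) V0); apply: eq_bigr => x _; rewrite (BT1_VZ FV).
Qed.

Lemma root_exists (a : k) : exists b, b ^+ p == a.
Proof.
have [b Eb] := solve_monicpoly (fun i => if i == 0%N then a else 0) p_gt0.
exists b; rewrite Eb; apply/eqP; case: p p_gt0 => // n _.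
by rewrite big_ord_recl /= mulr1 big1 ?addr0 // => i _; rewrite mul0r.
Qed.

(** Roots of order [p] are needed because [V] is linear only for the inverse Frobenius, and to solve
    for preimages under [F]. *)
Definition proot (a : k) : k := xchoose (root_exists a).

Lemma prootK a : proot a ^+ p = a.
Proof. exact/eqP/(xchooseP (root_exists a)). Qed.

Lemma pexp_eq0 (a : k) : (a ^+ p == 0) = (a == 0).
Proof. by rewrite expf_eq0 p_gt0. Qed.

Section Action.
Variables (T : finType) (d : T -> M).
Hypotheses (d_span : <<codom d>>%VS = fullv) (card_T : #|T| = \dim {:M}).
Variables (nxt : T -> T) (killed : T -> bool) (kap : T -> k).
Hypotheses (nxt_inj : injective nxt) (kap_neq0 : forall x, kap x != 0).
Hypothesis F_d : forall x, F (d x) = if killed x then 0 else kap x *: d (nxt x).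
Hypothesis V_d : forall x, V (d (nxt x)) = if killed x then kap x *: d x else 0.

Local Notation co := (coordinate d).
Local Notation sp := (spanned d).

Let nxt_surj y : exists x, y = nxt x.
Proof. by exists (invF nxt_inj y); rewrite f_invF. Qed.

Lemma coordinate_F x v :
  co (nxt x) (F v) = if killed x then 0 else kap x * co x v ^+ p.
Proof.
rewrite {1}(coordinate_sum d_span v) BT1_F_sum.
rewrite (eq_bigr (fun y =>
  if ~~ killed y then (co y v ^+ p * kap y) *: d (nxt y) else 0)); last first.
  by move=> y _; rewrite F_d; case: ifP; rewrite ?scaler0 // scalerA.
rewrite -big_mkcond coordinate_bigsum.
rewrite (eq_bigr (fun y => if y == x then co y v ^+ p * kap y else 0)); last first.
  move=> y _; rewrite coordinateZ coordinate_basis // (inj_eq nxt_inj) eq_sym.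
  by case: eqP => _ /=; rewrite ?mulr1 ?mulr0.
by rewrite -big_mkcondr big_mkcondl big_pred1_eq mulrC; case: (killed x).
Qed.

(** The statement concerns the [p]-th power of the coordinate, as [V] extracts [p]-th roots of
    scalars. *)
Lemma coordinate_V x v :
  co x (V v) ^+ p = if killed x then kap x ^+ p * co (nxt x) v else 0.
Proof.
have Ev : v = \sum_y proot (co y v) ^+ p *: d y.
  by rewrite {1}(coordinate_sum d_span v); apply: eq_bigr => y _; rewrite prootK.
rewrite {1}Ev BT1_V_sum (reindex nxt) /=; last by apply/onW_bij/injF_bij.
rewrite (eq_bigr (fun y =>
  if killed y then (proot (co (nxt y) v) * kap y) *: d y else 0)); last first.
  by move=> y _; rewrite V_d; case: ifP; rewrite ?scaler0 // scalerA.
rewrite -big_mkcond coordinate_comb //; case: ifP => _; last by rewrite expr0n gtn_eqF.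
by rewrite exprMn prootK mulrC.
Qed.

(** These sets index the image under [F] and the preimage under [V] of the span of [A]. If
    [killed x] fails, [V] is zero on the vector at [nxt x], which therefore lies in every such
    preimage. *)
Definition imageF (A : {set T}) := [set nxt x | x in A & ~~ killed x].
Definition preimV (A : {set T}) := [set nxt x | x : T & ~~ killed x || (x \in A)].

Lemma mem_imageF A x : (nxt x \in imageF A) = (x \in A) && ~~ killed x.
Proof. by rewrite mem_imset // inE. Qed.

Lemma mem_preimV A x : (nxt x \in preimV A) = ~~ killed x || (x \in A).
Proof. by rewrite mem_imset // inE. Qed.

Lemma spanned_imageF A v :
  v \in sp (imageF A) <-> exists2 u, u \in sp A & v = F u.
Proof.
split=> [/(mem_spanned d_span card_T) v0 | [u /(mem_spanned d_span card_T) u0 ->]].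
  (* The coordinate [c x] solves [kap x * c x ^+ p = co (nxt x) v]. *)
  pose c x := proot (co (nxt x) v / kap x).
  pose u := \sum_(x | (x \in A) && ~~ killed x) c x *: d x.
  exists u.
    apply/(mem_spanned d_span card_T) => x nAx.
    by rewrite coordinate_comb // (negbTE nAx).
  apply: (coordinate_eq d_span) => y; have [x ->] := nxt_surj y.
  rewrite coordinate_F coordinate_comb //.
  have [xA|xA] := boolP ((x \in A) && ~~ killed x).
    by case/andP: xA => _ /negbTE->; rewrite prootK mulrC divfK.
  rewrite v0 ?mem_imageF //.
  by rewrite expr0n gtn_eqF // mulr0 if_same.
apply/(mem_spanned d_span card_T) => y; have [x ->] := nxt_surj y.
rewrite mem_imageF coordinate_F; case: ifP => //= _; rewrite andbT => /u0->.
by rewrite expr0n gtn_eqF // mulr0.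
Qed.

Lemma spanned_preimV A v : (v \in sp (preimV A)) = (V v \in sp A).
Proof.
apply/(mem_spanned d_span card_T)/(mem_spanned d_span card_T) => v0.
  move=> x nAx; apply/eqP; rewrite -pexp_eq0 coordinate_V; case: ifP => // kx.
  by rewrite v0 ?mulr0 // mem_preimV kx (negbTE nAx).
move=> y; have [x ->] := nxt_surj y; rewrite mem_preimV negb_or negbK => /andP[kx nAx].
have := coordinate_V x v; rewrite v0 // kx expr0n gtn_eqF // => /esym/eqP.
by rewrite mulf_eq0 pexp_eq0 (negbTE (kap_neq0 x)) => /eqP.
Qed.

Lemma spanned_kerF v : (F v == 0) = (v \in sp [set x | killed x]).
Proof.
apply/eqP/(mem_spanned d_span card_T) => [Fv0 x|v0].
  rewrite inE => nk; have := coordinate_F x v; rewrite Fv0 coordinate0 (negbTE nk).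
  by move/esym/eqP; rewrite mulf_eq0 pexp_eq0 (negbTE (kap_neq0 x)) => /eqP.
apply: (coordinate_eq d_span) => y; have [x ->] := nxt_surj y.
rewrite coordinate_F coordinate0; case: ifP => // nk.
by rewrite v0 ?inE ?nk // expr0n gtn_eqF // mulr0.
Qed.

End Action.
End MonomialBT1.

(** * Final filtrations *)

Lemma count_wlt_nth s (S : seq word) : sorted wle S -> s < size S ->
  count (fun v => wlt v (nth [::] S s)) S <= s.
Proof.
move=> S_sorted lts; set u := nth [::] S s.
(* As [u] is not strictly below itself, the predicate can be [wlt] to [u] itself; all smaller words
   then sit in the initial segment. *)
have := @count_take_sorted s S (fun v => wlt v u) S_sorted lts.
rewrite {1}/wlt /wle lexx => /(_ isT) E.
have -> : count (fun v => wlt v u) S = count (predI (fun v => wlt v u) (fun v => wlt v u)) S.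
  by apply: eq_count => v; rewrite /= andbb.
rewrite -E (take_nth [::]) // -cats1 count_cat /= {2}/wlt /wle lexx !addn0.
by apply: leq_trans (count_size _ _) _; rewrite size_takel // ltnW.
Qed.

Lemma count_wle_nth s (S : seq word) : sorted wle S -> s < size S ->
  s < count (fun v => wle v (nth [::] S s)) S.
Proof.
move=> S_sorted lts; rewrite -[X in count _ X](cat_take_drop s.+1 S) count_cat.
suff /eqP-> : count (fun v => wle v (nth [::] S s)) (take s.+1 S) == s.+1 by apply: leq_addr.
rewrite -[X in _ == X](size_takel lts) -all_count; apply/(all_nthP [::]) => i.
rewrite size_takel // => lti; rewrite nth_take //.
apply: (sorted_leq_nth wle_trans) => //; rewrite ?inE //.
- by move=> v; apply: lexx.
- exact: leq_trans lts.
Qed.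

Section FinalFiltration.
Local Open Scope ring_scope.
Variables (k : closedFieldType) (M : vectType k) (F V : M -> M) (q : nat).
Variable C : nat -> {vspace M}.
Hypotheses (dim_M : \dim {:M} = q.*2) (final_C : final_filtration F V q C).

Lemma final_filtration0 : C 0%N = 0%VS.
Proof. by have [C_dim _ _ _] := final_C; apply/eqP; rewrite -dimv_eq0 C_dim. Qed.

Lemma final_filtration_full : C q.*2 = fullv.
Proof.
by have [C_dim _ _ _] := final_C; apply/eqP; rewrite eqEdim subvf C_dim ?dim_M ?leqnn.
Qed.

(** From one member to the next the dimension of the intersection grows by at most one, so it takes
    every value from 0 to [\dim U]; the first member that reaches [s] does so exactly. *)
Lemma final_filtration_dim_cap (U : {vspace M}) s : (s <= \dim U)%N ->
  exists2 t, (t <= q.*2)%N & \dim (C t :&: U) = s.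
Proof.
have [C_dim C_mono _ _] := final_C => le_s.
have step t : (t < q.*2)%N -> (\dim (C t.+1 :&: U) <= (\dim (C t :&: U)).+1)%N.
  move=> lt_t; have le_t : (t <= q.*2)%N by apply: ltnW.
  have sCC : (C t <= C t.+1)%VS by apply: C_mono; rewrite leqnSn.
  have := dimv_sum_cap (C t.+1 :&: U)%VS (C t).
  rewrite -capvA [(U :&: _)%VS]capvC capvA (capv_idPr sCC) C_dim //.
  have : (\dim (C t.+1 :&: U + C t)%VS <= t.+1)%N.
    apply: leq_trans (dimvS _) (eq_leq (C_dim _ lt_t)).
    by rewrite subv_add capvSl.
  lia.
have [t [le_t ge_s min_t]] : exists t, [/\ (t <= q.*2)%N, (s <= \dim (C t :&: U))%N
    & forall t', (t' < t)%N -> (\dim (C t' :&: U) < s)%N].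
  have ex : exists t, (s <= \dim (C t :&: U))%N.
    by exists q.*2; rewrite final_filtration_full capfv.
  case: (ex_minnP ex) => t ge_s min_t; exists t; split=> //.
    by apply: min_t; rewrite final_filtration_full capfv.
  by move=> t' lt_t'; rewrite ltnNge; apply: contraL lt_t' => /min_t; rewrite -leqNgt.
exists t => //; apply/eqP; rewrite eqn_leq ge_s andbT.
case: t le_t ge_s min_t => [|t] le_t _ min_t.
  by apply: leq_trans (dimvS (capvSl _ _)) _; rewrite C_dim.
by apply: leq_trans (step t le_t) _; apply: min_t.
Qed.

End FinalFiltration.

(** * Final filtrations in a basis indexed by positions *)

Section PositionBasis.
Local Open Scope ring_scope.
Variables (k : closedFieldType) (p : nat) (M : vectType k) (F V : M -> M).
Hypotheses (p_gt0 : (0 < p)%N) (FV : BT1 p F V).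
Variables (I : finType) (w : I -> word) (d : position w -> M).
Hypotheses (d_span : <<codom d>>%VS = fullv) (card_w : #|{: position w}| = \dim {:M}).
Variable kap : position w -> k.
Hypothesis kap_neq0 : forall x, kap x != 0.
Hypothesis F_d : forall x, F (d x) = if letter_at x then 0 else kap x *: d (next_pos x).
Hypothesis V_d : forall x, V (d (next_pos x)) = if letter_at x then kap x *: d x else 0.
Variable q : nat.
Hypothesis dim_M : \dim {:M} = q.*2.

Local Notation sp := (spanned d).
Local Notation imF := (imageF (@next_pos I w) (@letter_at I w)).
Local Notation preV := (preimV (@next_pos I w) (@letter_at I w)).

Let next_surj (y : position w) : exists x, y = next_pos x.
Proof. by exists (prev_pos y); rewrite prev_posK. Qed.

Section Canonical.
Variable C : nat -> {vspace M}.
Hypothesis final_C : final_filtration F V q C.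

(** Induction on [u]: putting [f] in front corresponds to applying [F], putting [v] in front to
    applying the inverse of [V], and the filtration is stable under both. A general [R] serves the
    strict and the weak order at once. *)
Lemma final_filtration_past (R : rel word) :
  (forall a b u v, R (a :: u) (b :: v) = (a < b)%O || (a == b) && R u v) ->
  forall u, exists2 t, (t <= q.*2)%N &
    C t = sp [set x | R (past (size u) x) u].
Proof.
move=> R_cons; have [C_dim _ C_F C_V] := final_C.
elim=> [|a u [t le_t Et]].
  (* For the empty word the span is the whole space or zero, according to whether [R] is weak or
     strict. *)
  have [R0|R0] := boolP (R [::] [::]).
    exists q.*2 => //; rewrite (final_filtration_full dim_M final_C) -(spannedT d_span card_w).
    by congr spanned; apply/setP=> x; rewrite !inE R0.
  exists 0%N => //; rewrite (final_filtration0 final_C) -(spanned0 d).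
  by congr spanned; apply/setP=> x; rewrite !inE (negbTE R0).
case: a.
  have [t' le_t' Et'] := C_V t le_t; exists t' => //; apply/vspaceP=> v.
  rewrite Et' Et -(spanned_preimV p_gt0 FV d_span card_w (@next_pos_inj I w) kap_neq0 V_d).
  congr (v \in sp _); apply/setP=> y; have [x ->] := next_surj y.
  rewrite mem_preimV ?inE; last exact: next_pos_inj.
  by rewrite [size _]/= past_next R_cons; case: (letter_at x).
have [t' le_t' Et'] := C_F t le_t; exists t' => //; apply/vspaceP=> v.
apply/idP/idP => [/Et'|].
  rewrite Et => /(spanned_imageF p_gt0 FV d_span card_w (@next_pos_inj I w) kap_neq0 F_d).
  congr (v \in sp _); apply/setP=> y; have [x ->] := next_surj y.
  rewrite mem_imageF ?inE; last exact: next_pos_inj.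
  by rewrite [size _]/= past_next R_cons; case: (letter_at x); rewrite ?andbT ?andbF.
move=> vP; apply/Et'; rewrite Et.
apply/(spanned_imageF p_gt0 FV d_span card_w (@next_pos_inj I w) kap_neq0 F_d).
move: vP; congr (v \in sp _); apply/setP=> y; have [x ->] := next_surj y.
rewrite mem_imageF ?inE; last exact: next_pos_inj.
by rewrite [size _]/= past_next R_cons; case: (letter_at x); rewrite ?andbT ?andbF.
Qed.

Variables (L : nat) (T0 : {set position w}) (S : seq word).
Hypotheses (L_gt0 : (0 < L)%N) (L_dvd : forall i, (size (w i) %| L)%N).
Hypothesis S_sorted : sorted wle S.
Hypothesis S_count : forall P : pred word, count P S = #|[set x in T0 | P (past L x)]|.

(** The intersection [U] lies between the spans of [A1] and [A2], and the positions in [A2] outside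
    [A1] all have past [u], hence the same letter. If it is [f], the kernel of [F] on [U] lies in
    the span of [A1]; if it is [v], the [f]-vectors indexed by [A1] span a complement of the
    kernel. *)
Lemma final_filtration_dim_ker s t : (s < size S)%N -> (t <= q.*2)%N ->
  \dim (C t :&: sp T0) = s.+1 ->
  dim_ker F (C t :&: sp T0) (count (fun v => letter v 0 == letter_v) (take s.+1 S)).
Proof.
move=> lts le_t dimU; have [C_dim C_mono _ _] := final_C.
set U := (C t :&: sp T0)%VS in dimU *; set u := nth [::] S s.
pose Z := sp [set x | letter_at x].
have kerE v : (F v == 0) = (v \in Z).
  by apply: (spanned_kerF p_gt0 FV d_span card_w _ kap_neq0 F_d); apply: next_pos_inj.
exists (U :&: Z)%VS; split=> [v|]; first by rewrite memv_cap kerE.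
have size_u : size u = L.
  have : u \in S by rewrite mem_nth.
  rewrite -has_pred1 has_count S_count => /card_gt0P[x]; rewrite inE => /andP[_ /eqP<-].
  by rewrite size_past.
have [t1 le_t1 Et1] := final_filtration_past wlt_cons u.
have [t2 le_t2 Et2] := final_filtration_past wle_cons u.
rewrite size_u in Et1 Et2.
pose A1 := [set x in T0 | wlt (past L x) u]; pose A2 := [set x in T0 | wle (past L x) u].
have Ec1 : (C t1 :&: sp T0)%VS = sp A1.
  by rewrite Et1 (spanned_capv d_span card_w); congr spanned; apply/setP=> x; rewrite !inE andbC.
have Ec2 : (C t2 :&: sp T0)%VS = sp A2.
  by rewrite Et2 (spanned_capv d_span card_w); congr spanned; apply/setP=> x; rewrite !inE andbC.
(* Members of the filtration are comparable. The wrong order would bound the dimension of [U] by [s]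
   here; for [A2] below, it would force equality. *)
have sA1U : (sp A1 <= U)%VS.
  have [le_tt|le_tt] := leqP t1 t; first by rewrite -Ec1 capvS // C_mono // le_tt.
  have : (\dim U <= #|A1|)%N.
    by rewrite -(dim_spanned d_span card_w) -Ec1 dimvS // capvS // C_mono // ltnW.
  by rewrite dimU /A1 -(S_count (fun v => wlt v u)) leqNgt ltnS count_wlt_nth.
have sUA2 : (U <= sp A2)%VS.
  have [le_tt|le_tt] := leqP t t2; first by rewrite -Ec2 capvS // C_mono // le_tt.
  have sA2U : (sp A2 <= U)%VS by rewrite -Ec2 capvS // C_mono // ltnW.
  suff -> : sp A2 = U by apply: subvv.
  apply/eqP; rewrite eqEdim sA2U dimU (dim_spanned d_span card_w).
  by rewrite /A2 -(S_count (fun v => wle v u)) count_wle_nth.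
have letterE (x : position w) : (letter (past L x) 0 == letter_v) = letter_at x.
  by rewrite (letter_past L_gt0 L_dvd); case: (letter_at x).
have A2E x : x \in A2 -> letter_at x != (letter u 0 == letter_v) -> x \in A1.
  rewrite !inE => /andP[-> le_xu] neq /=; apply: contra neq => le_ux.
  suff <- : past L x = u by rewrite letterE.
  by apply: wle_anti; rewrite le_xu le_ux.
have [u_v|u_f] := boolP (letter u 0 == letter_v); last first.
  rewrite (count_take_sorted (P := fun v => letter v 0 == letter_v)) // S_count.
  suff -> : (U :&: Z)%VS = sp (A1 :&: [set x | letter_at x]).
    rewrite (dim_spanned d_span card_w); apply: eq_card => x; rewrite !inE /=.
    by rewrite letterE -andbA [wlt _ _ && _]andbC.
  apply/eqP; rewrite eqEsubv -(spanned_capv d_span card_w); apply/andP; split; last exact: capvS.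
  rewrite subv_cap capvSr andbT; apply: subv_trans (capvS sUA2 (subvv _)) _.
  rewrite (spanned_capv d_span card_w) (spannedS d_span card_w) //.
  apply/subsetP=> x; rewrite inE => /andP[A2x]; rewrite inE => vx.
  by apply: A2E; rewrite // vx (negbTE u_f).
(* In the remaining case [u] ends in [v], and [U] is the direct sum of [Y] and the kernel. *)
pose Y := sp (A1 :&: [set x | ~~ letter_at x]).
have sYU : (Y <= U)%VS.
  by apply: subv_trans sA1U; rewrite (spannedS d_span card_w) // subsetIl.
have UE : U = (Y + U :&: Z)%VS.
  rewrite [(U :&: Z)%VS]capvC vspace_modl //; apply/esym/capv_idPr.
  apply: subv_trans sUA2 _; rewrite (spanned_addv d_span card_w) (spannedS d_span card_w) //.
  apply/subsetP=> x A2x; rewrite !inE; case: (boolP (letter_at x)) => vx; first by rewrite orbT.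
  by have := A2E x A2x; rewrite (negbTE vx) u_v => /(_ isT); rewrite inE => ->.
have YZ : (Y :&: (U :&: Z) = 0)%VS.
  apply/eqP; rewrite -subv0; apply: subv_trans (capvS (subvv Y) (capvSr U Z)) _.
  rewrite (spanned_capv d_span card_w) (_ : _ :&: _ = set0) ?spanned0 ?subvv //.
  by apply/setP=> x; rewrite !inE; case: (letter_at x); rewrite /= ?andbF.
have := dimv_disjoint_sum YZ; rewrite -UE dimU (dim_spanned d_span card_w).
(* The words not ending in [v] are counted instead, since [count_take_sorted] requires that [u] fail
   the predicate. *)
have := count_predC (fun v => letter v 0 == letter_v) (take s.+1 S).
rewrite [X in _ = X -> _]size_takel //.
rewrite (count_take_sorted (P := predC _)) //=; last by rewrite negbK.
rewrite S_count addnC (_ : #|[set x in T0 | _]| = #|A1 :&: [set x | ~~ letter_at x]|).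
  by move=> E1 /(etrans E1)/addnI.
by apply: eq_card => x; rewrite !inE /= letterE -andbA [wlt _ _ && _]andbC.
Qed.

End Canonical.

(** Positions are ordered by past, ties being broken by the factor; primitivity excludes ties inside
    a factor. Steps with equal letters preserve the order, as they move a common last letter to the
    front, and a step labelled [f] ends below every step labelled [v]. *)
Lemma final_filtration_exists L : (0 < L)%N ->
  (forall i, (size (w i) %| L)%N) -> (forall i, primitive (w i)) ->
  exists C, final_filtration F V q C.
Proof.
move=> L_gt0 L_dvd w_prim.
pose lt (y x : position w) := wlt (past L y) (past L x)
  || (past L y == past L x) && (enum_rank (tag y) < enum_rank (tag x))%N.
have lt_irr x : lt x x = false by rewrite /lt /wlt wle_refl eqxx ltnn.
have lt_total x y : x != y -> lt x y || lt y x.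
  move=> neq; rewrite /lt /wlt; have := wle_total (past L x) (past L y).
  case l1: (wle (past L x) (past L y)); case l2: (wle (past L y) (past L x)) => //= _;
    rewrite ?orbT //.
  have E : past L x = past L y by apply: wle_anti; rewrite l1 l2.
  rewrite E eqxx /= -neq_ltn; apply: contra neq => /eqP/ord_inj/enum_rank_inj Et.
  case: x y Et E {l1 l2} => i j [i' j'] /= Ei; case: i' / Ei j' => j' E.
  by rewrite (past_primitive_inj L_gt0 L_dvd (w_prim i) E).
have lt_trans y x z : lt x y -> lt y z -> lt x z.
  rewrite /lt => /orP[l1|/andP[/eqP-> l1]] /orP[l2|/andP[/eqP E l2]].
  - by rewrite (wlt_trans l1 l2).
  - by rewrite -E l1.
  - by rewrite l2.
  by rewrite E eqxx (ltn_trans l1 l2) orbT.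
have past_nextE (x : position w) : past L (next_pos x) = letter_at x :: past L.-1 x.
  by rewrite -{1}(prednK L_gt0) past_next.
have lt_next x y : lt x y -> letter_at x = letter_at y -> lt (next_pos x) (next_pos y).
  move=> lt_xy E; move: lt_xy; rewrite /lt !past_nextE !(past_rcons L_gt0 L_dvd) E.
  by rewrite wlt_rcons ?size_past // eqseq_rcons wlt_cons eqseq_cons !eqxx ltxx andbT.
have lt_next_fv x y : ~~ letter_at x -> letter_at y -> lt (next_pos x) (next_pos y).
  move=> fx vy; rewrite /lt !past_nextE wlt_cons.
  by rewrite vy (negbTE fx).
pose rank x := #|[set y | lt y x]|.
pose A t := [set x | (rank x < t)%N].
(* A downward closed set is the initial segment given by its cardinality, so stability reduces to
   downward closure. *)
have A_down (X : {set position w}) : (forall x y, x \in X -> lt y x -> y \in X) -> X = A #|X|.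
  move=> X_down; apply/setP=> x; rewrite inE /rank; apply/idP/idP => [Xx|].
    apply: proper_card; apply/properP; split.
      by apply/subsetP=> y; rewrite inE; apply: X_down.
    by exists x => //; rewrite inE lt_irr.
  apply: contraLR => nXx; rewrite -leqNgt subset_leq_card //.
  apply/subsetP=> y Xy; rewrite inE; have [E|neq] := eqVneq x y; first by rewrite E Xy in nXx.
  by case/orP: (lt_total _ _ neq) => // ltxy; rewrite (X_down y x) in nXx.
have rank_lt x : (rank x < q.*2)%N.
  rewrite -dim_M -card_w -cardsT; apply: proper_card; apply/properP; split.
    by apply/subsetP.
  by exists x; rewrite ?inE ?lt_irr.
have rank_inj : injective rank.
  have mono x y : lt x y -> (rank x < rank y)%N.
    move=> ltxy; apply: proper_card; apply/properP; split.
      by apply/subsetP=> z; rewrite !inE => /lt_trans; apply.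
    by exists x; rewrite inE ?lt_irr.
  move=> x y E; apply/eqP; apply: contraT => /lt_total/orP[]/mono; rewrite E ltnn //.
have card_A t : (t <= q.*2)%N -> #|A t| = t.
  move=> le_t; pose f x := Ordinal (rank_lt x).
  have f_inj : injective f by move=> x y /(congr1 val)/rank_inj.
  have f_surj i : i \in codom f.
    by apply: inj_card_onto => //; rewrite card_ord card_w dim_M.
  have -> : A t = f @^-1: [set i : 'I_(q.*2) | (i < t)%N] by apply/setP=> x; rewrite !inE.
  rewrite on_card_preimset; last first.
    by exists (fun i => iinv (f_surj i)) => x _; [apply: f_inj; rewrite f_iinv | rewrite f_iinv].
  rewrite -sum1_card (eq_bigl (fun i : 'I_(q.*2) => (i < t)%N)) => [|i]; last by rewrite inE.
  by rewrite -(@big_ord_widen _ _ addn t q.*2 (fun=> 1%N)) // sum1_card card_ord.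
have le_card (X : {set position w}) : (#|X| <= q.*2)%N.
  by rewrite -dim_M -card_w max_card.
have A_lt t x y : x \in A t -> lt y x -> y \in A t.
  rewrite !inE => lt_rx ltyx; apply: leq_ltn_trans lt_rx; apply: subset_leq_card.
  by apply/subsetP=> z; rewrite !inE => /lt_trans; apply.
exists (fun t => sp (A t)); split=> [t le_t|s t /andP[le_st _]|s le_s|s le_s].
- by rewrite (dim_spanned d_span card_w) card_A.
- by rewrite (spannedS d_span card_w) //; apply/subsetP=> x; rewrite !inE => /leq_trans; apply.
(* A position below the end of an [f]-step is itself entered by an [f]-step, and the order of the
   two starting points agrees with that of the ends. *)
- exists #|imF (A s)| => // v; rewrite -A_down.
    exact: (spanned_imageF p_gt0 FV d_span card_w (@next_pos_inj I w) kap_neq0 F_d).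
  move=> x' y'; have [x ->] := next_surj x'; have [y ->] := next_surj y'.
  rewrite !mem_imageF; try exact: next_pos_inj.
  case/andP=> Ax fx lt_yx; case: (boolP (letter_at y)) => [vy|fy].
    by have := lt_trans _ _ _ lt_yx (lt_next_fv _ _ fx vy); rewrite lt_irr.
  rewrite andbT; have [->//|neq] := eqVneq y x.
  case/orP: (lt_total _ _ neq) => [|/lt_next]; first exact: A_lt Ax.
  rewrite (negbTE fx) (negbTE fy) => /(_ erefl) lt_xy.
  by have := lt_trans _ _ _ lt_yx lt_xy; rewrite lt_irr.
exists #|preV (A s)| => // v; rewrite -A_down.
  exact: (spanned_preimV p_gt0 FV d_span card_w (@next_pos_inj I w) kap_neq0 V_d).
move=> x' y'; have [x ->] := next_surj x'; have [y ->] := next_surj y'.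
rewrite !mem_preimV; try exact: next_pos_inj.
case: (boolP (letter_at y)) => //= vy; case: (boolP (letter_at x)) => [vx /= Ax|fx _] lt_yx.
  have [->//|neq] := eqVneq y x.
  case/orP: (lt_total _ _ neq) => [|/lt_next]; first exact: A_lt Ax.
  rewrite vx vy => /(_ erefl) lt_xy.
  by have := lt_trans _ _ _ lt_yx lt_xy; rewrite lt_irr.
by have := lt_trans _ _ _ lt_yx (lt_next_fv _ _ fx vy); rewrite lt_irr.
Qed.
End PositionBasis.

(** * Modules attached to words *)

Lemma card_position (I : finType) (w : I -> word) :
  #|{: position w}| = \sum_i size (w i).
Proof.
rewrite -sum1_card (eq_bigr (fun i => \sum_(j < size (w i)) 1)) => [|i _].
  by rewrite sig_big_dep; apply: eq_bigl.
by rewrite sum1_card card_ord.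
Qed.

Section WordModules.
Local Open Scope ring_scope.
Variables (k : closedFieldType) (M : vectType k) (F V : M -> M).
Variables (I : finType) (w : I -> word) (N : I -> {vspace M}) (e : I -> seq M).
Hypothesis w_neq0 : forall i, w i <> [::].
Hypothesis factor_w : forall i, word_submodule F V (w i) (N i) (e i).
Hypotheses (sumN : (\sum_i N i)%VS = fullv) (directN : directv (\sum_i N i)).

Definition cyclic_basis i n : M := nth 0 (e i) (n %% size (w i))%N.

Lemma cyclic_basis_mod i n : cyclic_basis i (n %% size (w i))%N = cyclic_basis i n.
Proof. by rewrite /cyclic_basis modn_mod. Qed.

Let size_gt0 i : (0 < size (w i))%N.
Proof. by case: (w i) (@w_neq0 i). Qed.

Lemma cyclic_basis_FV i n :
  F (cyclic_basis i n) =
    (if letter (w i) (n %% size (w i))%N then 0 else cyclic_basis i n.+1) /\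
  V (cyclic_basis i n.+1) =
    (if letter (w i) (n %% size (w i))%N then cyclic_basis i n else 0).
Proof.
have [_ _ /(_ (n %% size (w i))%N (ltn_pmod _ (size_gt0 i)))] := factor_w i.
move=> /=; rewrite -!/(cyclic_basis i _) cyclic_basis_mod.
rewrite (_ : cyclic_basis i (_ %% _)%N.+1 = cyclic_basis i n.+1).
  by case: (letter _ _).
by rewrite /cyclic_basis -addn1 modnDml addn1.
Qed.

Definition word_basis (x : position w) : M := cyclic_basis (tag x) (tagged x).

Lemma mem_word_basis i u : u \in e i -> exists j : 'I_(size (w i)), u = word_basis (pos j).
Proof.
have [size_e _ _] := factor_w i; case/(nthP 0)=> n; rewrite size_e => ltn <-.
by exists (Ordinal ltn); rewrite /word_basis /cyclic_basis /= modn_small.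
Qed.

Lemma word_basis_span : <<codom word_basis>>%VS = fullv.
Proof.
apply/eqP; rewrite eqEsubv subvf -sumN; apply/subv_sumP=> i _.
have [_ be _] := factor_w i; rewrite -(span_basis be); apply: sub_span => u.
by case/mem_word_basis=> j ->; apply: codom_f.
Qed.

Lemma card_word_basis : #|{: position w}| = \dim {:M}.
Proof.
rewrite card_position -sumN (directvP directN) /=; apply: eq_bigr => i _.
by have [<- be _] := factor_w i; rewrite -(span_basis be) (eqnP (basis_free be)).
Qed.

Lemma word_basis_next x : word_basis (next_pos x) = cyclic_basis (tag x) (tagged x).+1.
Proof. by rewrite /word_basis /= cyclic_basis_mod. Qed.

(** The scalar [1] brings the formula into the shape with coefficients [kap]. *)
Lemma word_basis_F x :
  F (word_basis x) = if letter_at x then 0 else 1 *: word_basis (next_pos x).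
Proof.
by rewrite scale1r word_basis_next /word_basis (cyclic_basis_FV _ _).1 modn_small.
Qed.

Lemma word_basis_V x :
  V (word_basis (next_pos x)) = if letter_at x then 1 *: word_basis x else 0.
Proof. by rewrite scale1r word_basis_next (cyclic_basis_FV _ _).2 modn_small. Qed.

(** * Splitting the factors of square words *)

Section Squares.
Variables (p : nat) (z : I -> word) (r : I -> bool).
Hypothesis FV : BT1 p F V.
Hypothesis w_z : forall i, w i = if r i then z i ++ z i else z i.
Hypothesis two_neq0 : 2%:R != 0 :> k.

(** A factor contributes two indices if its word is a square, and one otherwise. *)
Let J := {i : I & 'I_(r i).+1}.
Let z' (j : J) := z (tag j).

(* When w = zz, the vectors a_j + a_{j+m} and a_j - a_{j+m}, with m the length of
   z, span two submodules on which F and V act as on the module of z, up to a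
   sign. *)
Definition split_vector i (h n : nat) : M :=
  if r i then cyclic_basis i n + (-1) ^+ h *: cyclic_basis i (n + size (z i))
  else cyclic_basis i n.

Definition split_basis (x : position z') : M :=
  split_vector (tag (tag x)) (tagged (tag x)) (tagged x).

(** Advancing by the length of [z] exchanges the two halves, so the summand [h] returns to itself up
    to [(-1) ^+ h]; this sign is placed on the step that closes the cycle. *)
Definition split_sign (x : position z') : k :=
  (-1) ^+ (if (tagged x).+1 == size (z (tag (tag x))) then tagged (tag x) : nat else 0%N).

Let size_w i : size (w i) = (if r i then size (z i) + size (z i) else size (z i))%N.
Proof. by rewrite w_z; case: (r i); rewrite ?size_cat. Qed.

Let size_z_gt0 i : (0 < size (z i))%N.
Proof. by have := size_gt0 i; rewrite size_w; case: (r i) => //; case: size. Qed.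

Let letter_w i n : letter (w i) (n %% size (w i))%N = letter (z i) (n %% size (z i))%N.
Proof.
rewrite size_w w_z; case: (r i) => //; rewrite /letter rev_cat nth_cat size_rev.
have z_gt0 := size_z_gt0 i.
have lt_n : (n %% (size (z i) + size (z i)) < size (z i) + size (z i))%N.
  by rewrite ltn_mod addn_gt0 z_gt0.
have -> : (n %% size (z i) = (n %% (size (z i) + size (z i))) %% size (z i))%N.
  by rewrite modn_dvdm // dvdn_addr.
move: (_ %% (_ + _))%N lt_n => m lt_m.
case: ltnP => [lt|le]; first by rewrite modn_small.
by rewrite -[in RHS](subnK le) modnDr modn_small // ltn_subLR.
Qed.

Let F_sign h u : F ((-1) ^+ h *: u) = (-1) ^+ h *: F u.
Proof.
have F0 : F 0 = 0 by apply: (@addrI _ (F 0)); rewrite -(BT1_FD FV) !addr0.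
rewrite -signr_odd; case: odd; rewrite ?expr0 ?scale1r // expr1 !scaleN1r.
by apply: (@addrI _ (F u)); rewrite -(BT1_FD FV) !subrr.
Qed.

Let V_sign h u : V ((-1) ^+ h *: u) = (-1) ^+ h *: V u.
Proof.
have V0 : V 0 = 0 by apply: (@addrI _ (V 0)); rewrite -(BT1_VD FV) !addr0.
rewrite -signr_odd; case: odd; rewrite ?expr0 ?scale1r // expr1 !scaleN1r.
by apply: (@addrI _ (V u)); rewrite -(BT1_VD FV) !subrr.
Qed.

Let split_vector_FV i h n :
  F (split_vector i h n) =
    (if letter (z i) (n %% size (z i))%N then 0 else split_vector i h n.+1) /\
  V (split_vector i h n.+1) =
    (if letter (z i) (n %% size (z i))%N then split_vector i h n else 0).
Proof.
have [F1 V1] := cyclic_basis_FV i n; rewrite letter_w in F1 V1.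
have [F2 V2] := cyclic_basis_FV i (n + size (z i)); rewrite letter_w modnDr in F2 V2.
rewrite /split_vector; case: (r i) => //.
rewrite (BT1_FD FV) (BT1_VD FV) F_sign V_sign addSn F1 F2 V1 V2.
by case: letter; rewrite ?scaler0 ?addr0.
Qed.

Let split_vector_mod i h n : r i ->
  split_vector i h (n + size (z i)) = (-1) ^+ h *: split_vector i h n.
Proof.
move=> ri; rewrite /split_vector ri scalerDr scalerA -expr2 sqrr_sign scale1r addrC.
congr (_ + _); rewrite -addnA; have := size_w i; rewrite ri => <-.
by rewrite -cyclic_basis_mod modnDr cyclic_basis_mod.
Qed.

Lemma split_basis_FV x :
  F (split_basis x) = (if letter_at x then 0 else split_sign x *: split_basis (next_pos x)) /\
  V (split_basis (next_pos x)) = (if letter_at x then split_sign x *: split_basis x else 0).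
Proof.
case: x => -[i h] n; rewrite /split_basis /split_sign /=.
have [EF EV] := split_vector_FV i h n.
have En : split_vector i h n.+1 = (-1) ^+ (if n.+1 == size (z i) then h : nat else 0%N) *:
    split_vector i h (n.+1 %% size (z i)).
  have [En|nEn] := eqVneq n.+1 (size (z i)); last first.
    rewrite scale1r modn_small // ltn_neqAle nEn; exact: ltn_ord n.
  rewrite En modnn; case/orP: (orbN (r i)) => [ri|/negbTE ri].
    by have := split_vector_mod h 0 ri; rewrite add0n.
  have -> : h = 0%N :> nat by have := ltn_ord h; rewrite ltnS {2}ri leqn0 => /eqP.
  by rewrite scale1r /split_vector ri -[LHS]cyclic_basis_mod size_w ri modnn.
have lt_n : (n < size (z i))%N := ltn_ord n.
rewrite /letter_at /z' /= EF -En (modn_small lt_n); split=> //.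
move: EV; rewrite En V_sign (modn_small lt_n).
(* The sign is its own inverse, so it can be moved to the other side. *)
move/(congr1 ( *:%R ((-1) ^+ (if n.+1 == size (z i) then h : nat else 0%N)))).
rewrite scalerA -expr2 sqrr_sign scale1r => ->.
by case: letter; rewrite ?scaler0.
Qed.

(** The sum and the difference of the two split vectors are twice the original vectors, and 2 is
    invertible. *)
Lemma split_basis_span : <<codom split_basis>>%VS = fullv.
Proof.
apply/eqP; rewrite eqEsubv subvf -word_basis_span; apply/span_subvP=> _ /codomP[[i n] ->].
rewrite /word_basis /=; have lt_n : (n < if r i then size (z i) + size (z i) else size (z i))%N.
  by rewrite -size_w.
have mem h m : (h < (r i).+1)%N -> (m < size (z i))%N ->
    split_vector i h m \in <<codom split_basis>>%VS.
  move=> lth ltm; apply: memv_span; apply/codomP.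
  by exists (@pos J z' (Tagged (fun i => 'I_(r i).+1) (Ordinal lth)) (Ordinal ltm)).
move: (nat_of_ord n) lt_n => {}n; case ri: (r i) => lt_n; last first.
  by have := mem 0%N n isT lt_n; rewrite /split_vector ri.
have lt1 : (1 < (r i).+1)%N by rewrite ri.
have half u : u *+ 2 \in <<codom split_basis>>%VS -> u \in <<codom split_basis>>%VS.
  by rewrite -scaler_nat => /(memvZ 2%:R^-1); rewrite scalerA mulVf // scale1r.
have [lt_nz|le_zn] := ltnP n (size (z i)).
  have := memvD (mem 0%N _ isT lt_nz) (mem 1%N _ lt1 lt_nz).
  rewrite /split_vector ri /= expr0 expr1 scale1r scaleN1r addrACA subrr addr0.
  exact: half.
have lt_nz : (n - size (z i) < size (z i))%N by rewrite ltn_subLR.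
have := memvB (mem 0%N _ isT lt_nz) (mem 1%N _ lt1 lt_nz).
rewrite /split_vector ri /= expr0 expr1 scale1r scaleN1r subnK //.
by rewrite opprB addrC addrA subrK; apply: half.
Qed.

Lemma card_split_basis : #|{: position z'}| = \dim {:M}.
Proof.
rewrite -card_word_basis !card_position.
rewrite -(@sig_big_dep _ _ _ _ (fun i => 'I_(r i).+1) xpredT (fun _ _ => true)
  (fun i _ => size (z i))).
apply: eq_bigr => i _; rewrite sum_nat_const card_ord size_w.
by case: (r i); rewrite ?mul1n // mul2n -addnn.
Qed.

End Squares.
End WordModules.

(** * Assembly of the theorem *)

Lemma cast_perm_gamma_of m n (E : m = n) z : cast_perm E (gamma_of m z) = gamma_of n z.
Proof. by case: n / E; rewrite cast_perm_id. Qed.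

Local Open Scope ring_scope.

Theorem theorem5p3 (p : nat) (k : closedFieldType) (char_k : p \in [pchar k])
    (p_gt2 : (2 < p)%N) (M : vectType k) (F V : M -> M)
    (lam : {skew_symmetric M}) (Mi : bool -> {vspace M}) (a b : nat)
    (unitaryM : unitary_BT1 p F V lam Mi) (signM : signature F Mi a b)
    (B : bool -> (a + b).-tuple M)
    (basisB : forall i, basis_of (Mi i) (B i))
    (F_preserves : preserves F (B false ++ B true))
    (V_preserves : preserves V (B false ++ B true))
    (W : seq word) (W_nonempty : forall w, w \in W -> w <> [::])
    (N : 'I_(size W) -> {vspace M}) (e : 'I_(size W) -> seq M)
    (factorW : forall i : 'I_(size W),
       word_submodule F V (nth [::] W i) (N i) (e i))
    (sumN : (\sum_i N i)%VS = fullv) (directN : directv (\sum_i N i))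
    (cond1 : forall i, {subset e i <= B false ++ B true})
    (cond2 : forall w, w \in W ->
       primitive w \/ exists z, [/\ w = z ++ z, primitive z & odd (size z)])
    (cond3 : forall i, nth 0 (e i) 0 \in B false) :
  exists Eq : q_of W = (a + b)%N,
    moonen_corresponds F V Mi a b (cast_perm Eq (gamma W)).
Proof.
pose w (i : 'I_(size W)) := nth [::] W i.
have Ww i : w i \in W by apply: mem_nth.
have w_neq0 i : w i <> [::] by apply: W_nonempty.
have p_gt0 : (0 < p)%N by apply: leq_trans p_gt2.
have FV := unitary_BT1_BT1 unitaryM.
have two_neq0 : 2%:R != 0 :> k.
  by rewrite -(dvdn_pcharf char_k) gtnNdvd.
pose L := lcm_size W.
have L_gt0 : (0 < L)%N by apply: lcm_size_gt0.
have L_dvd i : (size (w i) %| L)%N by apply: dvdn_lcm_size.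
have dim_Mi i : \dim (Mi i) = (a + b)%N by rewrite (size_basis (basisB i)).
have Mi_cap : (Mi false :&: Mi true = 0)%VS.
  exact/directv_addP/(unitary_BT1_direct unitaryM).
have dim_M : \dim {:M} = (a + b).*2.
  by rewrite -(unitary_BT1_sum unitaryM) dimv_disjoint_sum // !dim_Mi addnn.
pose d := word_basis (w := w) e.
have d_span : <<codom d>>%VS = fullv := word_basis_span factorW sumN.
have d_card : #|{: position w}| = \dim {:M} := card_word_basis factorW sumN directN.
have F_d := word_basis_F w_neq0 factorW.
have V_d := word_basis_V w_neq0 factorW.
have next_inj := @next_pos_inj _ w.
have one_neq0 (x : position w) : 1 != 0 :> k by apply: oner_neq0.
(* The degree alternates along each cycle, starting with [a_0] in [M_0]. On a [v]-step, [a_(n+1)] is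
   homogeneous because it belongs to [B]; in the wrong degree it would force [a_n] into both [M_0]
   and [M_1], although [a_n] is nonzero. *)
have d_Mi x : d x \in Mi (odd (tagged x)).
  case: x => i j; rewrite /d /word_basis /=.
  elim: (nat_of_ord j) => [|n IHn].
    by rewrite /cyclic_basis mod0n; apply: (basis_mem (basisB false)); apply: cond3.
  have [En Vn] := cyclic_basis_FV w_neq0 factorW i n.
  case v: (letter (w i) (n %% size (w i))%N) in En Vn; last first.
    by rewrite -En; apply: (unitary_BT1_F unitaryM).
  have [size_e be _] := factorW i.
  have mem_e m : cyclic_basis w e i m \in e i.
    by rewrite mem_nth // size_e ltn_mod lt0n size_eq0; apply/eqP/w_neq0.
  have [c Mc] : exists c, cyclic_basis w e i n.+1 \in Mi c.
    have := cond1 i _ (mem_e n.+1); rewrite mem_cat.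
    by case/orP=> /(basis_mem (basisB _)) Mc; eexists; exact: Mc.
  have := unitary_BT1_V unitaryM Mc; rewrite Vn => Mn.
  have : cyclic_basis w e i n != 0 := free_not0 (basis_free be) (mem_e n).
  move: Mc; rewrite /=; have [->//|neq _] := eqVneq c (~~ odd n).
  have Ec : c = odd n by move: neq; case: c {Mn}; case: odd.
  rewrite Ec in Mn; case/eqP; apply/eqP; rewrite -memv0 -Mi_cap memv_cap.
  by case: (odd n) Mn IHn => /= -> ->.
pose T0 := [set x : position w | ~~ odd (tagged x)].
have sub_Mi c : (spanned d [set x : position w | odd (tagged x) == c] <= Mi c)%VS.
  apply/subv_sumP=> x; rewrite inE => /eqP<-; exact: d_Mi.
(* The even and the odd positions span subspaces of [M_0] and [M_1], and together they number
   [(a + b).*2], so neither inclusion can be proper. *)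
have M0E : Mi false = spanned d T0.
  apply/esym/eqP.
  have -> : T0 = [set x : position w | odd (tagged x) == false].
    by apply/setP=> x; rewrite !inE eqbF_neg.
  rewrite eqEdim sub_Mi (dim_spanned d_span d_card) dim_Mi.
  have := dimvS (sub_Mi true); rewrite (dim_spanned d_span d_card) dim_Mi.
  have := cardsC [set x : position w | odd (tagged x) == false].
  have -> : ~: [set x : position w | odd (tagged x) == false]
      = [set x : position w | odd (tagged x) == true].
    by apply/setP=> x; rewrite !inE; case: odd.
  by rewrite d_card dim_M; lia.
pose S := sort wle (Wtilde W).
have S_sorted : sorted wle S by apply: sort_sorted wle_total _.
have S_count P : count P S = #|[set x in T0 | P (past L x)]|.
  rewrite (seq.permP (permEl (perm_sort _ _))) count_Wtilde //.
  by apply: eq_card => x; rewrite !inE.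
pose is_v (u : word) := letter u 0 == letter_v.
have card_T0 : #|T0| = (a + b)%N by rewrite -(dim_Mi false) M0E (dim_spanned d_span d_card).
have size_S : size S = (a + b)%N.
  by rewrite -count_predT S_count -card_T0; apply: eq_card => x; rewrite !inE andbT.
have Eq : q_of W = (a + b)%N by rewrite /q_of -size_S size_sort.
(* The number [b] from the signature is the dimension of the kernel of [F] on [M_0], which is
   spanned by the vectors at even positions with letter [v]. *)
have count_v : count is_v S = b.
  have [_ [K [KE <-]]] := signM; rewrite S_count -(dim_spanned d_span d_card).
  congr (\dim _); apply/vspaceP=> v; rewrite KE.
  rewrite (spanned_kerF p_gt0 FV d_span d_card next_inj one_neq0 F_d).
  rewrite M0E -memv_cap (spanned_capv d_span d_card); congr (v \in spanned d _).
  by apply/setP=> x; rewrite !inE /is_v letter_past //; case: letter_at.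
exists Eq; pose z := [seq s <- iota 0 (a + b) | is_v (nth [::] S s)].
have -> : cast_perm Eq (gamma W) = gamma_of (a + b) z.
  by rewrite cast_perm_gamma_of /z -Eq.
have size_z : size z = b.
  rewrite size_filter -[RHS]count_v -size_S.
  by rewrite -[in RHS](mkseq_nth [::] S) /mkseq count_map.
split.
- apply: gamma_of_min_coset_reps => //.
    by apply: sorted_filter; [apply: ltn_trans | apply: iota_ltn_sorted].
  by apply/allP=> s; rewrite mem_filter mem_iota => /andP[].
(* For existence, every word is replaced by its primitive root, used once or twice, and the split
   basis takes the place of the standard one. *)
- have [zr zrP] : exists zr : 'I_(size W) -> word * bool, forall i,
      w i = (if (zr i).2 then (zr i).1 ++ (zr i).1 else (zr i).1) /\ primitive (zr i).1.
    apply: (@fin_all_exists _ (fun=> (word * bool)%type) (fun i u =>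
      w i = (if u.2 then u.1 ++ u.1 else u.1) /\ primitive u.1)) => i.
    by case: (cond2 _ (Ww i)) => [prim|[u [Ew prim _]]]; [exists (w i, false) | exists (u, true)].
  pose u i := (zr i).1; pose r i := (zr i).2.
  have w_u i : w i = if r i then u i ++ u i else u i := (zrP i).1.
  have split_FV := split_basis_FV w_neq0 factorW FV w_u.
  apply: (final_filtration_exists p_gt0 FV (split_basis_span factorW sumN w_u two_neq0)
    (card_split_basis factorW sumN directN w_u) _ (fun x => (split_FV x).1)
    (fun x => (split_FV x).2) dim_M L_gt0) => [x|[i h]|[i h]] /=.
  + by rewrite signr_eq0.
  + apply: dvdn_trans (L_dvd i); rewrite (w_u i); case: (r i) => //.
    by rewrite size_cat addnn -mul2n dvdn_mull.
  + exact: (zrP i).2.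
(* For an arbitrary filtration, [eta s] is the number of words ending in [v] among the first [s], so
   it jumps after [s] exactly when the word of index [s], counted from 0, ends in [v]. *)
move=> C final_C; exists (fun s => count is_v (take s S)).
  split=> [|s /andP[s_gt0 le_s]]; first by rewrite take0.
  have [|t le_t dim_t] := @final_filtration_dim_cap _ _ _ _ _ _ dim_M final_C (Mi false) s.
    by rewrite dim_Mi.
  exists t; split=> //; move: dim_t; rewrite M0E -(prednK s_gt0).
  apply: (final_filtration_dim_ker p_gt0 FV d_span d_card one_neq0 F_d V_d dim_M final_C
    L_gt0 L_dvd S_sorted S_count _ le_t).
  by rewrite size_S prednK.
congr gamma_of; apply: eq_in_filter => s; rewrite mem_iota add0n => /andP[_ lts].
rewrite (take_nth [::]) ?size_S // -cats1 count_cat /= addn0.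
by case: (is_v _); rewrite /= ?addn1 ?eqxx // addn0 ltn_eqF.
Qed.
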